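(* Let $\phi:\Sigma^*\to\Gamma^*$ be an injective morphism and let $u\in\Sigma^*$. Let $m=\sum_{x\in\mathrm{Im}(\phi)}|x|$, $w=\phi(u)$, $n=|w|$, and $\mathit{occ}=\sum_{x\in\mathrm{Im}(\phi)}\mathrm{occ}(x,w)$. Then whether $\phi$ is interference-free on $\{u\}$ can be decided in $O(m+n+\mathit{occ})$ expected time.
   Context: $\mathrm{Im}(\phi)=\{\phi(c):c\in\Sigma\}$; $\mathrm{occ}(x,w)$ is the number of (possibly overlapping) occurrences of $x$ in $w$. $\phi$ is injective if $\phi(u)\neq\phi(v)$ for $u\ne v$. A word admits an image factorization if it is a concatenation of zero or more images. A word $w$ admits an interfered image factorization if $w=xyz$ with $x$ a proper (possibly empty) suffix of some image, $y$ admitting an image factorization, $z$ a proper (possibly empty) prefix of some image, and $xz\neq\varepsilon$. A word is an inner image factor if it is a proper factor of some image $\phi(c)$ that is neither a prefix nor a suffix of $\phi(c)$. For injective $\phi$, $\phi$ is interference-free on $\mathcal{L}$ if for every non-empty $u\in\mathcal{L}$, $\phi(u)$ admits no interfered image factorization and is not an inner image factor. *)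

(* Defs.v *)
From mathcomp Require Import all_boot all_order all_algebra.
Set Implicit Arguments. Unset Strict Implicit. Unset Printing Implicit Defensive.

Section Words.
Variables Sigma Gamma : finType.
Implicit Types (phi : Sigma -> seq Gamma) (x y z w v : seq Gamma).

(* A morphism of free monoids is given by its values [phi] on letters;
   [morph phi] is its extension to words. *)
Definition morph phi (u : seq Sigma) : seq Gamma := flatten [seq phi c | c <- u].

(* Im(phi) is a set: a word that is the image of several letters is listed
   once, so that sums over Im(phi) count it once. *)
Definition images phi : seq (seq Gamma) := undup [seq phi c | c <- enum Sigma].

Definition proper_prefix x v := prefix x v && (x != v).
Definition proper_suffix x v := suffix x v && (x != v).

Definition image_factorization phi w : Prop :=
  exists2 s : seq (seq Gamma), {subset s <= images phi} & w = flatten s.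

Definition interfered_image_factorization phi w : Prop :=
  exists x y z : seq Gamma,
    [/\ w = x ++ y ++ z,
        exists2 v, v \in images phi & proper_suffix x v,
        image_factorization phi y,
        exists2 v, v \in images phi & proper_prefix z v
      & x ++ z <> [::]].

Definition inner_image_factor phi w : Prop :=
  exists c : Sigma,
    [/\ infix w (phi c), w <> phi c, ~~ prefix w (phi c) & ~~ suffix w (phi c)].

(* Only meaningful when [morph phi] is injective. *)
Definition interference_free phi (L : seq Sigma -> Prop) : Prop :=
  forall u, L u -> u <> [::] ->
    ~ interfered_image_factorization phi (morph phi u) /\
    ~ inner_image_factor phi (morph phi u).

Definition occ x w : nat :=
  count (fun i => prefix x (drop i w)) (iota 0 (size w).+1).

Definition total_length phi : nat := \sum_(x <- images phi) size x.

Definition total_occ phi w : nat := \sum_(x <- images phi) occ x w.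

End Words.

(* Randomized word RAM with words of [W] bits, i.e. numbers below 2 ^ W.
   A program is a while-program over finitely many registers and finitely many
   word-indexed arrays of words, with the arithmetic operations on words and
   the generation of a uniformly random word.  Register and array names occur
   as constants in the program text; only array indices are computed. *)

Inductive binop := OpAdd | OpSub | OpMul | OpDiv | OpMod | OpLt | OpEq.

Inductive expr :=
| Const of nat
| Reg of nat
| Get of nat & expr
| Bin of binop & expr & expr.

Inductive cmd :=
| Assign of nat & expr
| Put of nat & expr & expr
| Rand of nat
| If of expr & seq cmd & seq cmd
| While of expr & seq cmd.

Definition program := seq cmd.

Record state := State { reg : nat -> nat; arr : nat -> nat -> nat }.

Definition eval_binop (W : nat) (o : binop) (a b : nat) : nat :=
  match o with
  | OpAdd => (a + b) %% 2 ^ W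
  | OpSub => (a + (2 ^ W - b)) %% 2 ^ W
  | OpMul => (a * b) %% 2 ^ W
  | OpDiv => a %/ b
  | OpMod => a %% b
  | OpLt => a < b
  | OpEq => a == b
  end.

Fixpoint eval (W : nat) (s : state) (e : expr) : nat :=
  match e with
  | Const k => k %% 2 ^ W
  | Reg x => reg s x
  | Get a i => arr s a (eval W s i)
  | Bin o e1 e2 => eval_binop W o (eval W s e1) (eval W s e2)
  end.

Definition upd (T : Type) (f : nat -> T) (x : nat) (v : T) : nat -> T :=
  fun y => if y == x then v else f y.

Definition set_reg (s : state) (x v : nat) : state :=
  State (upd (reg s) x v) (arr s).

Definition set_arr (s : state) (a i v : nat) : state :=
  State (reg s) (upd (arr s) a (upd (arr s a) i v)).

(* The commands still to be executed, and the current state. *)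
Definition config := (program * state)%type.

Definition halted (k : config) : bool := nilp k.1.

(* One time unit: an elementary command or one test of a conditional or loop.
   The expressions evaluated in a step are taken from the program text, so they
   have constant size.  The word [r] is the one delivered if the step is a
   [Rand]; other steps ignore it. *)
Definition step (W : nat) (k : config) (r : nat) : config :=
  let: (p, s) := k in
  match p with
  | [::] => k
  | Assign x e :: q => (q, set_reg s x (eval W s e))
  | Put a i e :: q => (q, set_arr s a (eval W s i) (eval W s e))
  | Rand x :: q => (q, set_reg s x r)
  | If e p1 p2 :: q => ((if eval W s e != 0 then p1 else p2) ++ q, s)
  | While e p1 :: q => (if eval W s e != 0 then p1 ++ p else q, s)
  end.

Definition run (W : nat) (k : config) (tape : seq nat) : config :=
  foldl (step W) k tape.

(* Number of steps before halting, truncated at the length of the tape. *)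
Fixpoint run_time (W : nat) (k : config) (tape : seq nat) : nat :=
  if tape is r :: tape' then
    if halted k then 0 else (run_time W (step W k r) tape').+1
  else 0.

(* E[min(T, t)], where T is the running time from [k]: the random words are
   independent and uniform, and at most [t] of them are used in [t] steps. *)
Definition mean_time (W : nat) (k : config) (t : nat) : rat :=
  ((\sum_(tape : t.-tuple 'I_(2 ^ W)) run_time W k [seq val r | r <- tape])%:R
     / ((2 ^ W) ^ t)%:R)%R.

(* By monotone convergence E[T] is the supremum of the E[min(T, t)].  In
   particular a finite bound entails termination with probability 1. *)
Definition expected_time_le (W : nat) (k : config) (b : nat) : Prop :=
  forall t : nat, (mean_time W k t <= b%:R)%R.

Definition accepts (s : state) : bool := reg s 0 != 0.

(* Randomness affects the running time only: every halting run answers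
   correctly. *)
Definition decides (W : nat) (k : config) (P : Prop) : Prop :=
  forall tape : seq nat, all (fun r => r < 2 ^ W) tape ->
    halted (run W k tape) -> (accepts (run W k tape).2 <-> P).

(* Letters are represented by their ranks in the alphabets.  Registers 0 and 1
   hold #|Sigma| and |u|; arrays 0, 1 and 2 hold the concatenation of all the
   phi(c), their lengths, and u; everything else is 0. *)
Definition input (Sigma Gamma : finType) (phi : Sigma -> seq Gamma)
    (u : seq Sigma) : state :=
  State
    (nth 0 [:: #|Sigma|; size u])
    (nth (fun=> 0)
      [:: nth 0 [seq val (enum_rank a) | a <- flatten [seq phi c | c <- enum Sigma]];
          nth 0 [seq size (phi c) | c <- enum Sigma];
          nth 0 [seq val (enum_rank c) | c <- u]]).

(* Main.v *)
(* The occurrences of images in [w] are the edges of a graph on the positions of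
   [w]: an occurrence of [v] at [i] leads from [i] to [i + |v|].  Call [i] a start
   if [w[0..i)] is a proper suffix of an image, and [j] an end if [w[j..n)] is a
   proper prefix of an image.  Then [w] has an interfered image factorization iff
   some path leads from a start [i] to an end [j] with [(i, j) <> (0, n)].

   All of this can be read off the Aho-Corasick automaton of the images and [w].
   Failure links are computed in breadth-first order, in linear time because the
   number of failure steps telescopes along each word.  Marks propagated along
   failure links from the images give the starts; the failure chain of [w] gives
   the ends; dictionary links list the edges into each position, each at constant
   cost, so that the total cost of a reachability pass is [n + occ]; and [w] is a
   factor of an image iff it is a suffix of one of the nodes on its path.

   The transitions of the trie are stored in a table directly addressed by pairs
   (node, letter).  Since the memory is initially zero, this needs neither
   initialization nor hashing, and the algorithm is deterministic. *)
Require Import Defs.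
From mathcomp Require Import all_boot all_order all_algebra.
From mathcomp Require Import zify.
Set Implicit Arguments. Unset Strict Implicit. Unset Printing Implicit Defensive.

(** * A program logic with time credits *)

(** No [Rand] is executed, so one derivation of [exec] describes the run on every tape, and the
    expected time is bounded by a worst-case time. Three amortizations are paid with time credits:
    failure steps by the shrinking of the failure link, marking steps by the number of nodes still
    unmarked, dictionary steps by the number of images that are suffixes of the current prefix,
    which sums to at most [occ]. The breadth-first order runs over positions of the text, not over
    nodes: positions sharing a node are each treated anew, so that the failure costs telescope along
    the text itself. A node is numbered by the least position that spells it; its number is thus
    fixed before the trie is built, and invariants can refer to the finished trie. Injectivity makes
    the images non-empty and distinct for distinct letters, so the input lists [Im(phi)] without
    repetition, and the numbers of letters in [Sigma] and in [u] are bounded by [m] and [n]. *)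

Fixpoint cmd_regs (c : cmd) : seq nat :=
  match c with
  | Assign x _ | Rand x => [:: x]
  | Put _ _ _ => [::]
  | If _ p1 p2 => flatten (map cmd_regs p1) ++ flatten (map cmd_regs p2)
  | While _ p => flatten (map cmd_regs p)
  end.

Fixpoint cmd_arrs (c : cmd) : seq nat :=
  match c with
  | Assign _ _ | Rand _ => [::]
  | Put a _ _ => [:: a]
  | If _ p1 p2 => flatten (map cmd_arrs p1) ++ flatten (map cmd_arrs p2)
  | While _ p => flatten (map cmd_arrs p)
  end.

Definition prog_regs (p : program) := flatten (map cmd_regs p).
Definition prog_arrs (p : program) := flatten (map cmd_arrs p).

(** A syntactic account of what a program may write; thanks to [exec_frame], loop invariants mention
    only what their loop changes. *)
Record frame (p : program) (s s' : state) : Prop := Frame {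
  frame_reg : forall x, x \notin prog_regs p -> reg s' x = reg s x;
  frame_arr : forall a, a \notin prog_arrs p -> arr s' a = arr s a }.

Section Logic.
Variable W : nat.

(** There is no rule for [Rand]: a derivation does not depend on the tape. *)
Inductive exec : program -> state -> nat -> state -> Prop :=
| ExecNil s : exec [::] s 0 s
| ExecAssign x e q s t s' :
    exec q (set_reg s x (eval W s e)) t s' -> exec (Assign x e :: q) s t.+1 s'
| ExecPut a i e q s t s' :
    exec q (set_arr s a (eval W s i) (eval W s e)) t s' ->
    exec (Put a i e :: q) s t.+1 s'
| ExecIf e p1 p2 q s t s' :
    exec ((if eval W s e != 0 then p1 else p2) ++ q) s t s' ->
    exec (If e p1 p2 :: q) s t.+1 s'
| ExecWhile e p q s t s' :
    exec (if eval W s e != 0 then p ++ While e p :: q else q) s t s' ->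
    exec (While e p :: q) s t.+1 s'.

Lemma exec_run p s t s' tape :
  exec p s t s' -> size tape = t -> run W (p, s) tape = ([::], s').
Proof.
move=> H; elim: H tape => {p s t s'} [s|x e q s t s' _ IH|a i e q s t s' _ IH|
  e p1 p2 q s t s' _ IH|e p q s t s' _ IH] [|r tape] //= [] /IH //.
Qed.

Lemma exec_cat p q s t s' t' s'' :
  exec p s t s' -> exec q s' t' s'' -> exec (p ++ q) s (t + t') s''.
Proof.
move=> H Hq; elim: H Hq => {p s t s'} [s|x e p s t s' _ IH|a i e p s t s' _ IH|
  e p1 p2 p s t s' _ IH|e p1 p s t s' _ IH] Hq //=.
- by constructor; apply: IH.
- by constructor; apply: IH.
- by constructor; rewrite catA; apply: IH.
- by constructor; move: (IH Hq); case: ifP => // _; rewrite -catA.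
Qed.

Lemma frame_refl p s : frame p s s.
Proof. by []. Qed.

Lemma frame_trans p s1 s2 s3 : frame p s1 s2 -> frame p s2 s3 -> frame p s1 s3.
Proof.
move=> [r1 a1] [r2 a2]; split=> x Hx; first by rewrite r2 // r1.
by rewrite a2 // a1.
Qed.

Lemma frame_sub p q s s' :
  {subset prog_regs p <= prog_regs q} -> {subset prog_arrs p <= prog_arrs q} ->
  frame p s s' -> frame q s s'.
Proof.
move=> Hr Ha [r a]; split=> x Hx; first by apply: r; apply: contra Hx => /Hr.
by apply: a; apply: contra Hx => /Ha.
Qed.

Lemma frame_tail c p s s' : frame p s s' -> frame (c :: p) s s'.
Proof. by apply: frame_sub => x Hx; rewrite /prog_regs /prog_arrs /= mem_cat Hx orbT. Qed.

Lemma exec_frame p s t s' : exec p s t s' -> frame p s s'.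
Proof.
elim=> {p s t s'} [s|x e p s t s' _ IH|a i e p s t s' _ IH|
  e p1 p2 p s t s' _ IH|e p1 p s t s' _ IH].
- exact: frame_refl.
- apply: frame_trans (frame_tail _ IH); split=> // y.
  by rewrite /prog_regs /= inE negb_or /upd => /andP[/negbTE-> _].
- apply: frame_trans (frame_tail _ IH); split=> // y.
  by rewrite /prog_arrs /= inE negb_or /upd => /andP[/negbTE-> _].
- by apply: frame_sub IH => y; rewrite /prog_regs /prog_arrs /= map_cat flatten_cat
    !mem_cat; case: ifP => _ /orP[]->; rewrite ?orbT.
- apply: frame_sub IH => y; case: ifP => _; rewrite /prog_regs /prog_arrs /=;
  by rewrite ?map_cat ?flatten_cat ?mem_cat => /=; rewrite ?mem_cat;
     do ?[move=> ->; rewrite ?orbT //]; case/or3P=> ->; rewrite ?orbT.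
Qed.

(* [k] counts time credits: every step of [p] consumes one, and [Q] receives
   what is left.  Potential functions are lower bounds on credits. *)
Definition wp (p : program) (Q : state -> nat -> Prop) (s : state) (k : nat) :=
  exists t s', [/\ t <= k, exec p s t s' & Q s' (k - t)].

Lemma wp_nil (Q : state -> nat -> Prop) s k : Q s k -> wp [::] Q s k.
Proof. by exists 0, s; rewrite subn0; split=> //; constructor. Qed.

Lemma wp_step (c : cmd) p q (Q : state -> nat -> Prop) s0 s k :
  (forall t s', exec p s t s' -> exec (c :: q) s0 t.+1 s') ->
  0 < k -> wp p Q s k.-1 -> wp (c :: q) Q s0 k.
Proof.
move=> H k0 [t [s' [tk Hx HQ]]]; exists t.+1, s'; split; [lia|exact: H|].
by have -> : k - t.+1 = k.-1 - t by lia.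
Qed.

Lemma wp_assign x e q Q s k :
  0 < k -> wp q Q (set_reg s x (eval W s e)) k.-1 -> wp (Assign x e :: q) Q s k.
Proof. by apply: wp_step => t s'; constructor. Qed.

Lemma wp_put a i e q Q s k :
  0 < k -> wp q Q (set_arr s a (eval W s i) (eval W s e)) k.-1 ->
  wp (Put a i e :: q) Q s k.
Proof. by apply: wp_step => t s'; constructor. Qed.

Lemma wp_seq p q (R Q : state -> nat -> Prop) s k :
  wp p R s k -> (forall s' k', frame p s s' -> R s' k' -> wp q Q s' k') ->
  wp (p ++ q) Q s k.
Proof.
move=> [t [s' [tk Hx HR]]] /(_ s' (k - t) (exec_frame Hx) HR).
move=> [t' [s'' [tk' Hx' HQ]]]; exists (t + t'), s''; split; first lia.
  exact: exec_cat Hx Hx'.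
by rewrite subnDA.
Qed.

Lemma wp_if e p1 p2 q Q s k :
  0 < k -> (eval W s e != 0 -> wp (p1 ++ q) Q s k.-1) ->
  (eval W s e = 0 -> wp (p2 ++ q) Q s k.-1) ->
  wp (If e p1 p2 :: q) Q s k.
Proof.
move=> k0 H1 H2; apply: (@wp_step _ ((if eval W s e != 0 then p1 else p2) ++ q) _ _ _ s) k0 _.
  by move=> t s'; apply: ExecIf.
by case: eqP => [/H2|/eqP/H1].
Qed.

(** Credits double as the termination measure, since each test consumes one. The frame is relative
    to the state at loop entry. *)
Lemma wp_while (I : state -> nat -> Prop) e p q Q s k :
  I s k ->
  (forall s' k', frame [:: While e p] s s' -> I s' k' -> eval W s' e != 0 ->
     0 < k' /\ wp p I s' k'.-1) ->
  (forall s' k', frame [:: While e p] s s' -> I s' k' -> eval W s' e = 0 ->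
     0 < k' /\ wp q Q s' k'.-1) ->
  wp (While e p :: q) Q s k.
Proof.
move=> HI Hbody Hend.
suff H b : forall k1 s1, k1 < b -> frame [:: While e p] s s1 -> I s1 k1 ->
    wp (While e p :: q) Q s1 k1 by exact: (H k.+1).
elim: b => // b IH k1 s1 kb Hf HI1.
case: (eqVneq (eval W s1 e) 0) => He.
  have [k0 Hw] := Hend _ _ Hf HI1 He; apply: wp_step k0 Hw => t s' Hx.
  by apply: ExecWhile; rewrite He.
have [k0 [t [s2 [tk Hx HI2]]]] := Hbody _ _ Hf HI1 He.
have [||t' [s3 [tk' Hx' HQ]]] := IH (k1.-1 - t) s2 _ (frame_trans Hf _) HI2; first lia.
  by have := exec_frame Hx; apply: frame_sub => y; rewrite /prog_regs /prog_arrs /= cats0.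
exists (t + t').+1, s3; split; first lia.
  by apply: ExecWhile; rewrite He; apply: exec_cat Hx Hx'.
by have -> : k1 - (t + t').+1 = k1.-1 - t - t' by lia.
Qed.

Lemma wp_weaken p (Q Q' : state -> nat -> Prop) s k :
  wp p Q s k -> (forall s' k', frame p s s' -> Q s' k' -> Q' s' k') -> wp p Q' s k.
Proof.
move=> [t [s' [tk Hx HQ]]] H; exists t, s'; split=> //; apply: H HQ.
exact: exec_frame Hx.
Qed.

End Logic.

(** * Suffixes, tries and failure links *)

Section LongestSuffix.
Variable A : eqType.
Implicit Types (s t v : seq A) (q r : pred (seq A)).

Lemma suffix_consE v a s : suffix v (a :: s) = (v == a :: s) || suffix v s.
Proof.
apply/idP/orP => [/suffixP[[|b x] /= E]|[/eqP->|]]; first by left; rewrite E.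
- by right; case: E => _ ->; apply: suffix_suffix.
- exact: suffix_refl.
- by move=> H; rewrite -cat1s; apply: suffix_catr.
Qed.

Lemma suffix_behead v s : suffix v s -> v != s -> suffix v (behead s).
Proof.
case: s => [|a s]; first by rewrite suffixs0 => ->.
by rewrite suffix_consE => /orP[->|].
Qed.

Lemma behead_suffix s : suffix (behead s) s.
Proof. by case: s => //= a s; apply: suffix_cons. Qed.

Lemma suffix_size_eq v s : suffix v s -> size s <= size v -> v = s.
Proof.
move=> /suffixP[x E]; rewrite E size_cat => H.
by have /size0nil -> : size x = 0 by lia.
Qed.

Lemma suffix_total s t v : suffix s v -> suffix t v -> size s <= size t -> suffix s t.
Proof.
move=> /suffixP[x ->] /suffixP[y E] H.
apply/suffixP; exists (drop (size y) x).
have Hy : size y <= size x by have := congr1 size E; rewrite !size_cat; lia.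
move: E; rewrite -{1}(cat_take_drop (size y) x) -catA => /eqP.
by rewrite eqseq_cat ?size_takel // => /andP[_ /eqP].
Qed.

(* The longest suffix satisfying [q]; junk value [[::]] if there is none. *)
Fixpoint lsuf q s := if q s then s else if s is _ :: s' then lsuf q s' else [::].

Lemma lsuf_nil q : lsuf q [::] = [::].
Proof. by rewrite /= if_same. Qed.

Lemma lsuf_suffix q s : suffix (lsuf q s) s.
Proof.
elim: s => [|a s IH] /=; first by case: ifP.
case: ifP => _; [exact: suffix_refl|exact: suffix_trans IH (suffix_cons _ _)].
Qed.

Lemma lsuf_prop q s : q [::] -> q (lsuf q s).
Proof. by move=> q0; elim: s => [|a s IH] /=; case: ifP. Qed.

Lemma lsuf_or q s : q (lsuf q s) || (lsuf q s == [::]).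
Proof.
by elim: s => [|a s IH] /=; case: ifP => [->|_] //; rewrite eqxx orbT.
Qed.

Lemma lsuf_max q s t : suffix t s -> q t -> suffix t (lsuf q s).
Proof.
elim: s => [|a s IH]; first by rewrite suffixs0 => /eqP-> /= ->.
move=> Ht qt /=; case: ifPn => // Hq; move: Ht; rewrite suffix_consE.
by case/predU1P => [E|/IH]; [rewrite -E qt in Hq|apply].
Qed.

Lemma lsuf_id q s : q s -> lsuf q s = s.
Proof. by case: s => [|a s] /= ->. Qed.

Lemma lsuf_behead q s : ~~ q s -> lsuf q s = lsuf q (behead s).
Proof. by case: s => [|a s] /= /negbTE->. Qed.

(** The longest [q]-suffix satisfies [r], so it is a suffix of the longest [r]-suffix. With images
    among the nodes, dictionary links can be read off failure links. *)
Lemma lsuf_lsuf q r s : (forall t, q t -> r t) -> lsuf q (lsuf r s) = lsuf q s.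
Proof.
move=> qr; elim: s => [|a s IH]; first by rewrite /=; case: ifP.
rewrite [lsuf r _]/=; case: ifPn => // Hr.
by rewrite IH [RHS]/= ifN //; apply: contra Hr; apply: qr.
Qed.

(** The recurrence behind failure links: for a prefix-closed [q], a non-empty [q]-suffix of
    [rcons s a] without its last letter is a [q]-suffix of [s], hence a suffix of the longest
    one. *)
Lemma lsuf_rcons q s a :
  q [::] -> (forall t b, q (rcons t b) -> q t) ->
  lsuf q (rcons s a) = lsuf q (rcons (lsuf q s) a).
Proof.
move=> q0 qp; elim: s => [|b s IH]; first by rewrite [lsuf q [::]]/= if_same.
rewrite [lsuf q (b :: s)]/=; case: ifPn => // Hq; rewrite -IH.
by rewrite lsuf_behead //; apply: contra Hq; apply: qp.
Qed.

End LongestSuffix.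

(** * The trie of a text, its failure links and the breadth-first queue *)

Section Trie.
Variables (A : eqType) (T : nat -> A) (fs : nat -> bool) (N : nat).
Implicit Types (s t v x : seq A) (a : A).

(* Words are laid out one after the other in the text [T], those starting at a
   position [k] with [fs k].  The prefix of a word that ends just before
   position [p] is [pref p]; its trie node is numbered by the least such [p]. *)
Fixpoint pref p := if p is k.+1 then rcons (if fs k then [::] else pref k) (T k) else [::].

Definition par k := if fs k then [::] else pref k.

Definition ids s := find (fun p => pref p == s) (iota 0 N.+1).

(** [find] returns [N.+1] when it fails. *)
Definition node s := ids s <= N.

Lemma prefS k : pref k.+1 = rcons (par k) (T k). Proof. by []. Qed.

Lemma size_pref p : size (pref p) <= p.
Proof. by elim: p => //= p IH; rewrite size_rcons; case: ifP. Qed.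

Lemma ids_le s p : p <= N -> pref p = s -> ids s <= p.
Proof.
move=> pN Ps; rewrite leqNgt; apply/negP => H.
by have := before_find 0 H; rewrite nth_iota ?add0n ?Ps ?eqxx.
Qed.

Lemma pref_ids s : node s -> pref (ids s) = s.
Proof.
move=> H; have /(nth_find 0) : has (fun p => pref p == s) (iota 0 N.+1).
  by rewrite has_find size_iota.
by rewrite nth_iota // => /eqP.
Qed.

Lemma node_pref p : p <= N -> node (pref p).
Proof. by move=> H; apply: leq_trans (ids_le H erefl) H. Qed.

Lemma ids_node s : ids s <= N -> node s.
Proof. by []. Qed.

Lemma node_nil : node [::].
Proof. exact: (@node_pref 0). Qed.

Lemma ids_nil : ids [::] = 0.
Proof. by have := @ids_le [::] 0 isT erefl; case: (ids _). Qed.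

Lemma node_par k : k < N -> node (par k).
Proof. by move=> H; rewrite /par; case: (fs k); [exact: node_nil|apply: node_pref; lia]. Qed.

Lemma ids_inj s t : node s -> node t -> ids s = ids t -> s = t.
Proof. by move=> Hs Ht E; rewrite -(pref_ids Hs) E pref_ids. Qed.

Lemma ids_eq0 s : node s -> (ids s == 0) = (s == [::]).
Proof.
move=> Hs; apply/eqP/eqP => [E|->]; last exact: ids_nil.
by apply: ids_inj => //; rewrite ?node_nil ?ids_nil.
Qed.

Lemma ids_parent s a : node (rcons s a) ->
  exists k, [/\ k < N, ids (rcons s a) = k.+1, par k = s & T k = a].
Proof.
move=> H; have E := pref_ids H; case Ek: (ids _) E => [|k]; first by case: (s).
rewrite prefS => /rcons_inj[E1 E2]; exists k; split=> //.
by move: H; rewrite /node Ek.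
Qed.

(** The first position spelling a child comes right after one spelling its parent, unless the parent
    is the root, numbered 0. Prefix-closure of nodes follows. *)
Lemma ids_rcons s a : node (rcons s a) -> ids s < ids (rcons s a).
Proof.
move=> /ids_parent[k [kN -> Hp _]]; rewrite ltnS.
move: Hp; rewrite /par; case: (fs k) => E; last by apply: ids_le => //; lia.
by rewrite -E ids_nil.
Qed.

Lemma node_rcons s a : node (rcons s a) -> node s.
Proof. by move=> H; have := ids_rcons H; move: H; rewrite /node; lia. Qed.

Definition fail s := lsuf node (behead s).

Lemma fail_nil : fail [::] = [::].
Proof. exact: lsuf_nil. Qed.

Lemma fail1 a : fail [:: a] = [::].
Proof. exact: lsuf_nil. Qed.

Lemma fail_node s : node (fail s).
Proof. exact: lsuf_prop node_nil. Qed.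

Lemma fail_suffix s : suffix (fail s) s.
Proof. exact: suffix_trans (lsuf_suffix _ _) (behead_suffix _). Qed.

Lemma fail_size s : s != [::] -> size (fail s) < size s.
Proof.
by case: s => // a s _; rewrite ltnS;
            apply: size_suffix; apply: lsuf_suffix.
Qed.

Lemma fail_max s t : suffix t s -> t != s -> node t -> suffix t (fail s).
Proof. by move=> H1 H2 H3; apply: lsuf_max => //; apply: suffix_behead. Qed.

Lemma lsuf_node_step s a :
  s != [::] -> ~~ node (rcons s a) ->
  lsuf node (rcons s a) = lsuf node (rcons (fail s) a).
Proof.
case: s => // b s _ H; rewrite (lsuf_behead H) /= /fail /=.
by apply: lsuf_rcons; [exact: node_nil|exact: node_rcons].
Qed.

Hypothesis fs0 : fs 0.

(** A first letter needs its own case: extending the root by it would return the node itself, which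
    is not a proper suffix. *)
Lemma fail_prefS k : fail (pref k.+1) =
  if fs k then [::] else lsuf node (rcons (fail (pref k)) (T k)).
Proof.
rewrite prefS /par; case: ifPn => Hk; first by rewrite fail1.
case: k Hk => [|k _]; first by rewrite fs0.
case E: (pref k.+1) => [|a s]; first by have := congr1 size E; rewrite size_rcons.
by apply: lsuf_rcons; [exact: node_nil|exact: node_rcons].
Qed.

Lemma size_fail_prefS k : size (fail (pref k.+1)) <= (size (fail (par k))).+1.
Proof.
rewrite fail_prefS /par; case: (fs k) => //.
by apply: leq_trans (size_suffix (lsuf_suffix _ _)) _; rewrite size_rcons.
Qed.

(* Amortised number of failure steps at position [k]. *)
Definition cost k := 2 + size (fail (par k)) - size (fail (pref k.+1)).

Lemma costE k : cost k + size (fail (pref k.+1)) = 2 + size (fail (par k)).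
Proof. by have := size_fail_prefS k; rewrite /cost; lia. Qed.

(** Telescoping with potential [size (fail (pref j))]: each position contributes 2, and a new word
    only lowers the potential to 0. *)
Lemma sum_cost : \sum_(k <- iota 0 N) cost k <= 2 * N.
Proof.
suff H j : \sum_(k <- iota 0 j) cost k + size (fail (pref j)) <= 2 * j.
  by have := H N; lia.
elim: j => [|j IH]; first by rewrite big_nil [pref 0]/= fail_nil.
rewrite -addn1 iotaD big_cat big_cons big_nil /= add0n addn0 addn1.
have := costE j; have : size (fail (par j)) <= size (fail (pref j)).
  by rewrite /par; case: (fs j) => //; rewrite fail_nil.
by move: IH; set u := \sum_(k <- _) _; lia.
Qed.

(* [q] is the content of a FIFO queue of positions in which each position
   [k.+1] that does not start a word is inserted when [k] is extracted; [h]
   positions have been extracted. *)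
Definition queue_inv (q : seq nat) h :=
  [/\ uniq q, forall k, k \in q -> k < N,
      forall k, k < N -> fs k -> k \in q,
      forall k, k.+1 < N -> ~~ fs k.+1 -> (k.+1 \in q) = (k \in take h q) &
      forall i j, i < j < size q ->
        size (pref (nth 0 q i).+1) <= size (pref (nth 0 q j).+1)].

Lemma size_prefSS k : ~~ fs k.+1 -> size (pref k.+2) = (size (pref k.+1)).+1.
Proof. by move=> /negbTE H; rewrite prefS /par H size_rcons. Qed.

(** Induction along the word of [k]: word starts are queued from the outset, an extracted position
    queues its successor, and as the queue is sorted by depth, whatever is queued and shallower than
    the head has been extracted. *)
Lemma queue_before q h k : queue_inv q h -> h < size q -> k < N ->
  size (pref k.+1) < size (pref (nth 0 q h).+1) -> k \in take h q.
Proof.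
move=> [q1 q2 q3 q4 q5] hq kN lt.
have Hq : k \in q -> k \in take h q.
  move=> Hk; rewrite in_take //; rewrite ltnNge; apply/negP => hi.
  have ik : index k q < size q by rewrite index_mem.
  case: (eqVneq h (index k q)) => [E|ne]; first by move: lt; rewrite E nth_index // ltnn.
  by have := q5 h (index k q); rewrite nth_index // => /(_ _); lia.
elim: k kN lt Hq => [|k IH] kN lt Hq; apply: Hq; first by apply: q3.
case: (boolP (fs k.+1)) => Hf; first exact: q3.
rewrite q4 //; rewrite size_prefSS // in lt.
apply: IH; [lia|lia|move=> Hk].
rewrite in_take //; rewrite ltnNge; apply/negP => hi.
have ik : index k q < size q by rewrite index_mem.
case: (eqVneq h (index k q)) => [E|ne]; first by move: lt; rewrite E nth_index //; lia.
by have := q5 h (index k q); rewrite nth_index // => /(_ _); lia.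
Qed.

Lemma queue_step q h : fs N -> queue_inv q h -> h < size q ->
  let k := nth 0 q h in queue_inv (if fs k.+1 then q else rcons q k.+1) h.+1.
Proof.
move=> fsN [q1 q2 q3 q4 q5] hq k.
have kN : k < N by apply: q2; rewrite mem_nth.
have Ek : take h.+1 q = rcons (take h q) k by rewrite (take_nth 0).
case: ifPn => Hf.
  split=> // j jN Hj; rewrite q4 // Ek mem_rcons inE.
  by case: eqP => // E; case/negP: Hj; rewrite E.
have kN' : k.+1 < N.
  by rewrite ltn_neqAle kN andbT; apply: contraNneq Hf => ->.
have Hk : k.+1 \notin q.
  by have := take_uniq h.+1 q1; rewrite q4 // Ek rcons_uniq => /andP[].
split.
- by rewrite rcons_uniq Hk.
- by move=> j; rewrite mem_rcons inE => /predU1P[->|/q2].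
- by move=> j jN Hj; rewrite mem_rcons inE q3 ?orbT.
- move=> j jN Hj; rewrite mem_rcons inE q4 // -cats1 takel_cat // Ek mem_rcons inE.
  by rewrite eqSS.
- move=> i j; rewrite size_rcons !nth_rcons => /andP[ij jq].
  have iq' : i < size q by lia.
  rewrite iq'; case: (ltnP j (size q)) => jq'; first by apply: q5; rewrite ij.
  (* The new entry is one deeper than the head. An earlier entry has depth 1, or its predecessor [e]
     left the queue before the head and so is at most as deep as the head. *)
  have -> : j == size q by lia.
  rewrite size_prefSS //; have iq : nth 0 q i \in q by apply: mem_nth.
  have := q2 _ iq; case Ei: (nth 0 q i) iq => [|e] iq eN.
    by rewrite prefS /par fs0.
  case: (boolP (fs e.+1)) => He; first by rewrite prefS /par He.
  rewrite size_prefSS // ltnS; move: iq; rewrite q4 // => ie.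
  have := ie; rewrite in_take_leq ?(ltnW hq) // => lt.
  by have := q5 (index e q) h; rewrite nth_index ?(mem_take ie) //; apply; lia.
Qed.

Lemma queue_end q k : queue_inv q (size q) -> k < N -> k \in q.
Proof.
move=> [q1 q2 q3 q4 q5]; elim: k => [|k IH] kN; first exact: q3.
case: (boolP (fs k.+1)) => Hf; first exact: q3.
by rewrite q4 // take_size IH // ltnW.
Qed.

End Trie.

(** * Dictionary links, and reachability through images *)

Section Images.
Variables (A : eqType) (imgs : seq (seq A)).
Implicit Types (s t v x y w : seq A).

Definition ppre x v := prefix x v && (x != v).
Definition psuf x v := suffix x v && (x != v).

(** For a prefix [s] of [w], the number of edges arriving at its end, and the length of the
    dictionary chain walked there. *)
Definition cnt s := count (fun v => suffix v s) imgs.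

Definition dl s := lsuf (mem imgs) (behead s).

Lemma cnt_lsuf s : cnt (lsuf (mem imgs) s) = cnt s.
Proof.
elim: s => [|a s IH]; first by rewrite /=; case: ifP.
rewrite [lsuf _ _]/=; case: ifPn => // Hs; rewrite IH.
apply: eq_in_count => v Hv; rewrite suffix_consE.
by case: eqP => // E; case/negP: Hs; rewrite -E.
Qed.

Lemma dl_or s : (dl s \in imgs) || (dl s == [::]).
Proof. exact: (lsuf_or (mem imgs)). Qed.

Lemma dl_suffix s : suffix (dl s) s.
Proof. exact: suffix_trans (lsuf_suffix _ _) (behead_suffix _). Qed.

(** An image other than [y] and no longer would be a proper suffix of [y], hence no longer than
    [dl y]: the dictionary chain skips no image. *)
Lemma dl_next s y v : v \in imgs -> suffix v s -> suffix y s ->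
  size (dl y) < size v -> size v <= size y -> v = y.
Proof.
move=> Hv vs ys lt1 le2; apply/eqP; apply: contraLR lt1 => ne.
rewrite -leqNgt; apply: size_suffix; apply: lsuf_max => //.
exact: suffix_behead (suffix_total vs ys le2) ne.
Qed.

Definition imgf y := exists2 s : seq (seq A), {subset s <= imgs} & y = flatten s.

Variable w : seq A.

Definition is_start i := has (fun v => psuf (take i w) v) imgs.

(** Position 0 has the lower rank because, with the end [size w], it gives [x = z = [::]], which is
    excluded. From any other start every end is allowed. *)
Definition init i := if i == 0 then 1 else if is_start i then 2 else 0.

(* [reach b j]: some factorization into images leads to position [j] from a
   position [i] with [b <= init i], that is from 0 or a start if [b = 1] and
   from a start other than 0 if [b = 2]. *)
Definition reach b j := exists i, [/\ i <= j, b <= init i & imgf (drop i (take j w))].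

Lemma imgf_nil : imgf [::].
Proof. by exists [::]. Qed.

Lemma imgf_rcons y v : imgf y -> v \in imgs -> imgf (y ++ v).
Proof.
move=> [s Hs ->] Hv; exists (rcons s v); last by rewrite flatten_rcons.
by move=> u; rewrite mem_rcons inE => /orP[/eqP->|/Hs].
Qed.

(** Splitting off the last image of the factorization. *)
Lemma reach_step b j : j <= size w ->
  reach b j <-> b <= init j \/
    exists v, [/\ v \in imgs, suffix v (take j w) & reach b (j - size v)].
Proof.
move=> jn; split.
- move=> [i [ij Hb [s]]]; case/lastP: s => [_|s v Hs].
    move/(congr1 size); rewrite size_drop size_takel //= => E.
    by left; have -> : j = i by lia.
  rewrite flatten_rcons => E; right; exists v.
  have Hv : v \in imgs by apply: Hs; rewrite mem_rcons mem_head.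
  have Ej : take j w = (take i w ++ flatten s) ++ v.
    by rewrite -catA -E -(take_takel w ij) cat_take_drop.
  split=> //; first by rewrite Ej suffix_suffix.
  have sz := congr1 size Ej; rewrite !size_cat !size_takel in sz; try lia.
  exists i; split=> //; first lia.
  exists s; first by move=> u Hu; apply: Hs; rewrite mem_rcons inE Hu orbT.
  rewrite -(take_takel w (leq_subr _ j)) Ej take_size_cat; last first.
    by rewrite size_cat size_takel; lia.
  by rewrite drop_size_cat // size_takel; lia.
- case=> [Hb|[v [Hv /suffixP[x E] [i [ij Hb Hf]]]]].
    by exists j; split=> //; rewrite drop_oversize ?size_takel //; exact: imgf_nil.
  have sz := congr1 size E; rewrite size_cat size_takel // in sz.
  exists i; split=> //; first lia.
  have -> : drop i (take j w) = drop i (take (j - size v) w) ++ v.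
    rewrite -(take_takel w (leq_subr (size v) j)) E.
    have -> : j - size v = size x by lia.
    rewrite take_size_cat // drop_cat.
    case: ltnP => // H; rewrite [drop i x]drop_oversize //.
    have -> : i - size x = 0 by lia.
    by rewrite drop0.
  exact: imgf_rcons.
Qed.

Definition is_pp t := has (fun v => ppre t v) imgs.

Definition interf := exists x y z : seq A,
    [/\ w = x ++ y ++ z, exists2 v, v \in imgs & psuf x v, imgf y,
        exists2 v, v \in imgs & ppre z v & x ++ z <> [::]].

Hypothesis imgs_nil : [::] \notin imgs.

(** Rank 2 is asked only of the end [t = [::]], where [x] must be non-empty; a non-empty [z] allows
    every start. *)
Lemma interfP : imgs != [::] ->
  interf <-> exists t, [/\ suffix t w, is_pp t &
    reach (if t == [::] then 2 else 1) (size w - size t)].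
Proof.
move=> imgs0; split.
- move=> [x [y [z [E [v Hv Hx] Hy [v' Hv' Hz] ne]]]]; exists z; split.
  + by rewrite E catA suffix_suffix.
  + by apply/hasP; exists v'.
  exists (size x).
  have Ex : take (size x) w = x by rewrite E take_size_cat.
  split; first by rewrite E !size_cat; lia.
  + rewrite /init /is_start Ex.
    have -> : has (fun v => psuf x v) imgs by apply/hasP; exists v.
    by case: (size x =P 0) => [/size0nil x0|_]; case: eqP => // z0; rewrite x0 z0 in ne.
  + have -> : size w - size z = size (x ++ y) by rewrite E !size_cat; lia.
    by rewrite E catA take_size_cat // drop_size_cat.
- move=> [t [/suffixP[u Eu] /hasP[v' Hv' Hz] [i [ij Hb Hf]]]].
  have Eu' : size w - size t = size u by rewrite Eu size_cat; lia.
  rewrite Eu' {1}Eu take_size_cat // in Hf, ij.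
  exists (take i u), (drop i u), t; split=> //; last 2 first.
  + by exists v'.
  + case: (t =P [::]) Hb => [_ Hb|t0 _ H]; last first.
      by have := congr1 size H; rewrite size_cat; case: (t) t0 => //= ? ?; lia.
    move=> /(congr1 size); rewrite size_cat size_takel //.
    by move: Hb; rewrite /init; case: eqP => // i0 _ /=; lia.
  + by rewrite Eu catA cat_take_drop.
  have Ei : take i w = take i u by rewrite Eu takel_cat.
  move: Hb; rewrite /init /is_start Ei; case: (i =P 0) => [-> _|_].
    (* For [x = [::]] any image is a witness, being non-empty. *)
    case: (imgs) imgs0 imgs_nil => // v l _ /norP[v0 _].
    by exists v; rewrite ?mem_head // /psuf take0 suffix0s.
  by case: hasP => [[v Hv Hx] _|_]; [exists v|case: ifP].
Qed.

(** The images that are suffixes of [y] are [y], counted once, and the proper ones, all suffixes of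
    [dl y]. So each dictionary step is paid by one occurrence. *)
Lemma cnt_dl y : uniq imgs -> y \in imgs -> cnt y = (cnt (dl y)).+1.
Proof.
move=> imgs_uniq; case: y => [|a y] Hy; first by case/negP: imgs_nil.
rewrite /dl cnt_lsuf /cnt /=.
rewrite -[RHS]add1n -[1]/(nat_of_bool true) -Hy -(count_uniq_mem _ imgs_uniq).
rewrite -count_predUI (_ : count (predI _ _) _ = 0) ?addn0; last first.
  apply/eqP; rewrite -leqn0 leqNgt -has_count; apply/hasPn => v _ /=.
  by apply/negP => /andP[/eqP-> /size_suffix] /=; lia.
by apply: eq_count => v; rewrite suffix_consE.
Qed.

End Images.

(** * The algorithm *)

Ltac is_nat A := unify A nat.

Ltac arith_clear := repeat match goal with
  | H : ?X |- _ =>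
    lazymatch X with
    | is_true (leq _ _) => fail
    | is_true (leq _ _ && leq _ _) => fail
    | is_true (negb (@eq_op ?A _ _)) => tryif is_nat (Equality.sort A) then fail else clear H
    | @eq bool (leq _ _) _ => fail
    | @eq bool (@eq_op ?A _ _) _ => tryif is_nat (Equality.sort A) then fail else clear H
    | not (@eq ?A _ _) => tryif is_nat A then fail else clear H
    | @eq ?A _ _ => tryif is_nat A then lazymatch X with
        | context [arr] => clear H
        | context [reg] => clear H
        | context [if _ then _ else _] => clear H
        | _ => fail
        end
      else clear H
    | _ => lazymatch type of X with Prop => clear H | _ => fail end
    end
  end.
Ltac alia := arith_clear; repeat match goal with H : context [expn] |- _ => clear H end; lia.
Ltac ania := arith_clear; nia.

(* Arrays 0 to 2 hold the input.  [aT] receives a copy of [w] behind the images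
   and its letters are then recoded; [aQ] is the queue, initially the list of
   word starts, which are flagged in [aFs]; [aRen] maps letters to codes;
   [aChild] maps [x * K + a] to the child of node [x] by letter [a]; [aNd] and
   [aDep] map a position to its node and its depth.  On nodes: [aPp] flags the
   proper prefixes of images, [aImg] the images, [aHw] the words having [w] as a
   suffix, [aMk] the proper suffixes of images; [aF] is the failure link and
   [aDl] the dictionary link, i.e. the longest proper suffix that is an image.
   [aR] is indexed by the positions of [w] and described by [reach_inv]. *)
Notation aT := 0 (only parsing).
Notation aLen := 1 (only parsing).
Notation aU := 2 (only parsing).
Notation aQ := 3 (only parsing).
Notation aFs := 4 (only parsing).
Notation aRen := 5 (only parsing).
Notation aChild := 6 (only parsing).
Notation aNd := 7 (only parsing).
Notation aDep := 8 (only parsing).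
Notation aPp := 9 (only parsing).
Notation aImg := 10 (only parsing).
Notation aF := 11 (only parsing).
Notation aDl := 12 (only parsing).
Notation aHw := 13 (only parsing).
Notation aMk := 14 (only parsing).
Notation aR := 15 (only parsing).

Notation rM := 2 (only parsing).
Notation rN := 3 (only parsing).
Notation rK := 4 (only parsing).
Notation rBad := 5 (only parsing).
Notation rk := 6 (only parsing).
Notation rx := 7 (only parsing).
Notation ry := 8 (only parsing).
Notation rh := 9 (only parsing).
Notation rt := 10 (only parsing).

Notation Add := (Bin OpAdd).
Notation Sub := (Bin OpSub).
Notation Mul := (Bin OpMul).
Notation Lt := (Bin OpLt).
Notation Eq := (Bin OpEq).
Notation Incr x := (Assign x (Add (Reg x) (Const 1))).

(** Conditionals are computed arithmetically, so that loop bodies, apart from inner loops, are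
    straight-line code of fixed cost. *)
Definition NotE a := Eq a (Const 0).
Definition AndE a b := Mul (NotE (NotE a)) (NotE (NotE b)).
Definition OrE a b := NotE (Mul (NotE a) (NotE b)).
Definition IteE c a b := Add (Mul a (NotE (NotE c))) (Mul b (NotE c)).
Arguments NotE : simpl never.
Arguments AndE : simpl never.
Arguments OrE : simpl never.
Arguments IteE : simpl never.
Arguments pref : simpl never.
Arguments eval : simpl never.

(* The code of a letter is one more than the position of its first occurrence,
   so that codes, unlike letters, are at most [N] and [x * K + a] does not
   overflow. *)
Definition insert_loop : program :=
  [:: While (Lt (Reg rk) (Reg rN))
    [:: Put aRen (Get aT (Reg rk)) (IteE (Get aRen (Get aT (Reg rk)))
          (Get aRen (Get aT (Reg rk))) (Add (Reg rk) (Const 1)));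
        Put aT (Reg rk) (Get aRen (Get aT (Reg rk)));
        Assign rx (IteE (Get aFs (Reg rk)) (Const 0) (Get aNd (Reg rk)));
        Assign ry (IteE (Get aFs (Reg rk)) (Const 0) (Get aDep (Reg rk)));
        Put aPp (Reg rx) (OrE (Get aPp (Reg rx)) (Lt (Reg rk) (Reg rM)));
        Assign rh (Add (Mul (Reg rx) (Reg rK)) (Get aT (Reg rk)));
        Incr rk;
        Put aChild (Reg rh) (IteE (Get aChild (Reg rh)) (Get aChild (Reg rh)) (Reg rk));
        Put aNd (Reg rk) (Get aChild (Reg rh));
        Put aDep (Reg rk) (Add (Reg ry) (Const 1));
        Put aImg (Get aNd (Reg rk)) (OrE (Get aImg (Get aNd (Reg rk)))
          (AndE (NotE (Lt (Reg rM) (Reg rk))) (Get aFs (Reg rk))))]].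

Definition child_cell := Get aChild (Add (Mul (Reg rx) (Reg rK)) (Get aT (Reg rk))).

(** A cell 0 means no child, and 0 is also the root, where a failed search ends. The write to [aQ]
    is unconditional, but it joins the queue only if [rt] is then advanced. *)
Definition fail_loop : program :=
  [:: While (Lt (Reg rh) (Reg rt))
    [:: Assign rk (Get aQ (Reg rh));
        Incr rh;
        Assign rx (IteE (Get aFs (Reg rk)) (Const 0) (Get aF (Reg rk)));
        While (AndE (NotE child_cell) (Reg rx))
          [:: Assign rx (Get aF (Reg rx))];
        Assign rx (IteE (Get aFs (Reg rk)) (Const 0) child_cell);
        Incr rk;
        Put aF (Reg rk) (Reg rx);
        Put aDl (Reg rk) (IteE (Get aImg (Reg rx)) (Reg rx) (Get aDl (Reg rx)));
        Put aHw (Reg rk) (OrE (Eq (Get aNd (Reg rk)) (Get aNd (Reg rN)))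
                              (Get aHw (Reg rx)));
        Put aQ (Reg rt) (Reg rk);
        Assign rt (Add (Reg rt) (NotE (Get aFs (Reg rk))))]].

(** The root is marked beforehand and stops every walk; walks begin at the failure link of an image
    because only proper suffixes count. *)
Definition mark_loop : program :=
  [:: Put aMk (Const 0) (Const 1); Assign rk (Const 0);
      While (Lt (Reg rk) (Reg rM))
        [:: Incr rk;
            Assign rx (IteE (Get aFs (Reg rk)) (Get aF (Reg rk)) (Const 0));
            While (NotE (Get aMk (Reg rx)))
              [:: Put aMk (Reg rx) (Const 1); Assign rx (Get aF (Reg rx))]]].

Definition reach_loop : program :=
  [:: Put aR (Reg rM) (Const 1); Assign rk (Reg rM);
      While (Lt (Reg rk) (Reg rN))
        [:: Incr rk;
            Assign rx (Get aNd (Reg rk));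
            Put aR (Reg rk) (IteE (Get aMk (Reg rx)) (Const 2) (Const 0));
            Assign rx (IteE (Get aImg (Reg rx)) (Reg rx) (Get aDl (Reg rx)));
            While (Reg rx)
              [:: Assign ry (Get aR (Sub (Reg rk) (Get aDep (Reg rx))));
                  Put aR (Reg rk)
                    (IteE (Lt (Get aR (Reg rk)) (Reg ry)) (Reg ry) (Get aR (Reg rk)));
                  Assign rx (Get aDl (Reg rx))]]].

(** The test adds 1 to the rank at a non-empty end, so that rank 1 suffices there while the empty
    end requires rank 2. [ry] holds the node just treated, which lets the body run at the root
    too. *)
Definition end_loop : program :=
  [:: Assign rx (Get aNd (Reg rN)); Assign ry (Const 1);
      While (Reg ry)
        [:: Assign rBad (OrE (Reg rBad) (AndE (Get aPp (Reg rx))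
              (Lt (Const 1) (Add (Get aR (Sub (Reg rN) (Get aDep (Reg rx))))
                                 (Lt (Const 0) (Reg rx))))));
            Assign ry (Reg rx);
            Assign rx (Get aF (Reg rx))]].

(** [ry] and [rh] record whether [w] is a factor, respectively a prefix, of the current word as read
    so far; the verdict falls where the next position is flagged. *)
Definition inner_loop : program :=
  [:: Assign rk (Const 0);
      While (Lt (Reg rk) (Reg rM))
        [:: Assign ry (IteE (Get aFs (Reg rk)) (Const 0) (Reg ry));
            Assign rh (IteE (Get aFs (Reg rk)) (Const 0) (Reg rh));
            Incr rk;
            Assign ry (OrE (Reg ry) (Get aHw (Reg rk)));
            Assign rh (OrE (Reg rh) (Eq (Get aNd (Reg rk)) (Get aNd (Reg rN))));
            Assign rBad (OrE (Reg rBad) (AndE (Get aFs (Reg rk)) (AndE (Reg ry)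
              (AndE (NotE (Reg rh)) (NotE (Get aHw (Reg rk)))))))]].

(** * Evaluation of expressions without overflow *)

Section Eval.
Variables (N W : nat).

Lemma eval_const s c : eval W s (Const c) = c %% 2 ^ W. Proof. by []. Qed.
Lemma eval_reg s x : eval W s (Reg x) = reg s x. Proof. by []. Qed.
Lemma eval_get s a e : eval W s (Get a e) = arr s a (eval W s e). Proof. by []. Qed.
Lemma eval_add s a b : eval W s (Add a b) = (eval W s a + eval W s b) %% 2 ^ W.
Proof. by []. Qed.
Lemma eval_mul s a b : eval W s (Mul a b) = (eval W s a * eval W s b) %% 2 ^ W.
Proof. by []. Qed.
Lemma eval_lt s a b : eval W s (Lt a b) = (eval W s a < eval W s b). Proof. by []. Qed.
Lemma eval_eq s a b : eval W s (Eq a b) = (eval W s a == eval W s b). Proof. by []. Qed.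

Lemma wp_let x e q Q s k v : eval W s e = v ->
  wp W q Q (set_reg s x v) k -> wp W (Assign x e :: q) Q s k.+1.
Proof. by move=> <- H; apply: wp_assign. Qed.

Lemma wp_set a i e q Q s k j v : eval W s i = j -> eval W s e = v ->
  wp W q Q (set_arr s a j v) k -> wp W (Put a i e :: q) Q s k.+1.
Proof. by move=> <- <- H; apply: wp_put. Qed.

(** Exposes a numeral whose successors [wp_let] and [wp_set] consume. *)
Lemma credits c k : c <= k -> exists K, k = c + K.
Proof. by move=> ck; exists (k - c); rewrite subnKC. Qed.

Hypothesis HW : N.+2 * N.+2 <= 2 ^ W.

Lemma small_mod x : x < N.+2 * N.+2 -> x %% 2 ^ W = x.
Proof. by move=> H; apply: modn_small; apply: leq_trans HW. Qed.

Lemma small0 : 0 %% 2 ^ W = 0. Proof. by rewrite mod0n. Qed.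
Lemma small1 : 1 %% 2 ^ W = 1. Proof. by apply: small_mod; lia. Qed.
Lemma small2 : 2 %% 2 ^ W = 2. Proof. by apply: small_mod; lia. Qed.

Lemma eval_not s e : eval W s (NotE e) = (eval W s e == 0).
Proof. by rewrite /NotE eval_eq eval_const small0. Qed.

Lemma mul_bool x (b : bool) : (x * b) %% 2 ^ W = if b then x %% 2 ^ W else 0.
Proof. by case: b; rewrite ?muln1 ?muln0 ?mod0n. Qed.

Lemma eval_and s a b : eval W s (AndE a b) = (eval W s a != 0) && (eval W s b != 0).
Proof.
rewrite /AndE eval_mul !eval_not mul_bool.
by case: (eval W s a == 0); case: (eval W s b == 0); rewrite ?small1 ?small0.
Qed.

Lemma eval_or s a b : eval W s (OrE a b) = (eval W s a != 0) || (eval W s b != 0).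
Proof.
rewrite /OrE eval_not eval_mul !eval_not mul_bool.
by case: (eval W s a == 0); case: (eval W s b == 0); rewrite ?small1 ?small0.
Qed.

(* The other branch may be out of range, as it is multiplied by 0. *)
Lemma eval_iteE s c a b v :
  (if eval W s c != 0 then eval W s a else eval W s b) = v -> v < N.+2 * N.+2 ->
  eval W s (IteE c a b) = v.
Proof.
move=> <- Hv; rewrite /IteE eval_add !eval_mul !eval_not !mul_bool.
by move: Hv; case: (eval W s c == 0) => /= Hv; rewrite ?add0n ?addn0 modn_mod small_mod.
Qed.

Definition eval_rules := (eval_const, eval_reg, eval_get, eval_add, eval_mul, eval_lt,
  eval_eq, eval_not, eval_and, eval_or, small0, small1).

Lemma eval_subE s a b : eval W s b <= eval W s a -> eval W s a < N.+2 * N.+2 ->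
  eval W s (Sub a b) = eval W s a - eval W s b.
Proof.
move=> ba aB; rewrite -[LHS]/((eval W s a + (2 ^ W - eval W s b)) %% 2 ^ W).
have aW := leq_trans aB HW; rewrite addnBA; last by apply: ltnW; apply: leq_ltn_trans aW.
by rewrite addnC -addnBA // modnDl modn_small //; apply: leq_ltn_trans (leq_subr _ _) aW.
Qed.

End Eval.

Arguments small_mod {N W} HW x _.

(** * Correctness and cost of the phases *)

Section Phases.
Variables (A : eqType) (T : nat -> A) (fs : nat -> bool) (m N W : nat).
Variables (code rank : A -> nat).
Hypotheses (fs0 : fs 0) (fsm : fs m) (fsN : fs N) (m_gt0 : 0 < m) (mN : m < N).
Hypothesis fs_w : forall k, m < k < N -> ~~ fs k.
Hypothesis HW : N.+2 * N.+2 <= 2 ^ W.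
Hypothesis rank_inj : injective rank.
Hypothesis code_le : forall k, k < N -> 0 < code (T k) <= k.+1.
Hypothesis code_eq : forall i k, i < N -> k < N -> code (T i) = k.+1 -> T i = T k.

Local Notation pref := (pref T fs).
Local Notation par := (par T fs).
Local Notation ids := (ids T fs N).
Local Notation node := (node T fs N).
Local Notation small := (small_mod HW).
Local Notation evalE := (eval_rules HW).
Local Notation eval_ite := (eval_iteE HW).
Local Notation eval_sub := (eval_subE HW).

Lemma code_inj i j : i < N -> j < N -> code (T i) = code (T j) -> T i = T j.
Proof.
move=> iN jN; have := code_le jN; case E: (code (T j)) => [//|k] kj Ei.
by rewrite (code_eq iN _ Ei) ?(code_eq jN _ E) //; lia.
Qed.

Definition env (s : state) :=
  [/\ reg s rM = m, reg s rN = N, reg s rK = N.+1 &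
      forall p, p <= N -> arr s aFs p = fs p].

(** Stated with final codes and node numbers: both record first positions, so an entry is present
    after [k] steps exactly if its final value is at most [k]. *)
Definition trie_inv k (s : state) :=
  [/\ forall i, i < N -> arr s aT i = if i < k then code (T i) else rank (T i),
      forall i, i < N -> arr s aRen (rank (T i)) =
        if code (T i) <= k then code (T i) else 0,
      forall t i, node t -> i < N -> arr s aChild (ids t * N.+1 + code (T i)) =
        if ids (rcons t (T i)) <= k then ids (rcons t (T i)) else 0 &
      forall p, p <= k -> arr s aNd p = ids (pref p) /\ arr s aDep p = size (pref p)].

Definition class_inv k (s : state) :=
  (forall t, node t -> arr s aPp (ids t) != 0 <->
     exists i, [/\ i < k, i < m & par i = t]) /\
  (forall t, node t -> arr s aImg (ids t) != 0 <->
     exists p, [/\ 0 < p <= k, p <= m, fs p & pref p = t]).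

Lemma insert_ok s k k1 :
  env s -> reg s rk = 0 -> trie_inv 0 s -> class_inv 0 s -> 20 * N + 1 + k1 <= k ->
  wp W insert_loop (fun s' k' => [/\ trie_inv N s', class_inv N s' & k1 <= k']) s k.
Proof.
move=> [EM EN EK EF] E0 HT HC Hk.
apply: (@wp_while W (fun s k => [/\ reg s rk <= N, trie_inv (reg s rk) s,
  class_inv (reg s rk) s & 20 * (N - reg s rk) + 1 + k1 <= k])).
- by rewrite E0; split=> //; lia.
- move=> {E0 HT HC Hk}s' k' [Fr Fa] [kN HT HC Hk].
  rewrite !evalE (Fr rN isT) EN eqb0 negbK => ltk.
  have [|K EK'] := @credits 12 k'; first by alia.
  rewrite {}EK' in Hk *; split=> //.
  have [HTT HTR HTC HTN] := HT; have [HCp HCi] := HC.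
  set j := reg s' 6 in ltk kN HTT HTR HTC HTN HCp HCi *.
  have [c0 cj] := andP (code_le ltk).
  have ETj : arr s' aT j = rank (T j) by rewrite HTT // ltnn.
  have EFs : arr s' aFs j = fs j by rewrite (Fa aFs isT) EF.
  have par_le : ids (par j) <= j.
    by rewrite /par; case: ifP => _; [rewrite ids_nil|exact: ids_le].
  have idj : ids (pref j) <= j by apply: ids_le.
  have szj := size_pref T fs j.
  have [nj dj] := HTN j (leqnn _).
  have Nr : node (pref j.+1) by apply: node_pref.
  have r_le : ids (pref j.+1) <= j.+1 by apply: ids_le.
  have r_gt0 : 0 < ids (pref j.+1) by rewrite lt0n ids_eq0 // prefS; case: (par j).
  have Np : node (par j) by apply: node_par.
  apply: (wp_set (j := rank (T j)) (v := code (T j))); [exact: ETj| |].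
    apply: eval_ite; last ania.
    rewrite !evalE -/j ETj HTR // small; last ania.
    by case: leqP => ?; rewrite ?eqxx /= ?(gtn_eqF c0) /=; alia.
  apply: (wp_set (j := j) (v := code (T j))); [by []| |].
    by rewrite !evalE /= /upd /= -/j ETj eqxx.
  apply: (wp_let (v := ids (par j))).
    apply: eval_ite; last ania.
    rewrite !evalE /= /upd /= -/j EFs nj.
    by rewrite eqb0 negbK /par; case: ifP => //; rewrite ids_nil.
  apply: (wp_let (v := size (par j))).
    apply: eval_ite; last by apply: leq_ltn_trans (_ : _ <= j) _; [rewrite /par; case: ifP|ania].
    rewrite !evalE /= /upd /= -/j EFs dj.
    by rewrite eqb0 negbK /par; case: ifP.
  apply: (wp_set (j := ids (par j)) (v := (arr s' aPp (ids (par j)) != 0) || (j < m))).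
  - by [].
  - by rewrite !evalE /= /upd /= -/j (Fr rM isT) EM eqb0 negbK.
  apply: (wp_let (v := ids (par j) * N.+1 + code (T j))).
    rewrite !evalE /= /upd /= -/j eqxx (Fr rK isT) EK (small (_ * _)) ?small //; ania.
  apply: (wp_let (v := j.+1)).
    by rewrite !evalE /= /upd /= -/j small ?addn1 //; ania.
  have Hc := HTC _ _ Np ltk; rewrite -prefS in Hc.
  apply: (wp_set (j := ids (par j) * N.+1 + code (T j)) (v := ids (pref j.+1))).
  - by [].
  - apply: eval_ite; last ania.
    rewrite !evalE /= /upd /= Hc.
    by case: leqP => ?; rewrite ?eqxx /= ?(gtn_eqF r_gt0) /=; alia.
  apply: (wp_set (j := j.+1) (v := ids (pref j.+1))); [by []| |].
    by rewrite !evalE /= /upd /= eqxx.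
  apply: (wp_set (j := j.+1) (v := size (pref j.+1))); [by []| |].
    rewrite prefS size_rcons !evalE /= /upd /= small ?addn1 //.
    by have := size_pref T fs j; rewrite /par; case: ifP => _ /=; ania.
  apply: (wp_set (j := ids (pref j.+1))
     (v := (arr s' aImg (ids (pref j.+1)) != 0) || (j.+1 <= m) && fs j.+1)).
  - by rewrite !evalE /= /upd /= eqxx.
  - rewrite !evalE /= /upd /= eqxx (Fr rM isT) EM (Fa aFs isT) EF //.
    by rewrite !eqb0 !negbK -leqNgt; case: (fs j.+1); case: (_ <= _).
  apply: wp_nil => /=; rewrite /upd /=; split; [by []| | |alia].
  + split=> /=; rewrite /upd /=.
    * move=> i iN; case: eqP => [->|ne]; first by rewrite ltnSn.
      by rewrite HTT //; do 2 case: ifP => //; alia.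
    * move=> i iN; case: eqP => [/rank_inj->|ne]; first by case: ifP; alia.
      rewrite HTR //; do 2 case: ifP => //; try alia.
      by move=> H1 H2; case: ne; rewrite (code_eq iN ltk) //; alia.
    * move=> t i Nt iN; case: eqP => [E|ne].
        (* Codes are below [N.+1], so the index determines quotient and remainder. *)
        have := code_le iN => Hi; have [E1 E2] : ids t = ids (par j) /\ code (T i) = code (T j).
          by move: (ids t) (ids (par j)) E => x y E; have : x = y; ania.
        by rewrite (ids_inj Nt Np E1) (code_inj iN ltk E2) -prefS r_le.
      rewrite HTC //; do 2 case: ifP => //; try alia.
      (* A node numbered [j.+1] is spelled at position [j.+1], hence is the child of [par j] by
         [T j]. *)
      move=> H1 H2; case: ne; have E : ids (rcons t (T i)) = j.+1 by alia.
      have : pref j.+1 = rcons t (T i) by rewrite -E pref_ids //; apply: ids_node; rewrite E.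
      by rewrite prefS => /rcons_inj[-> ->].
    * by move=> p pj; case: eqP => [->//|ne]; apply: HTN; alia.
  + split=> /= t Nt; rewrite /upd /=.
    * case: (ids t =P _) => [/(ids_inj Nt Np) E|ne]; last first.
        rewrite HCp //; split=> -[i [ij im Ei]]; exists i; split=> //; first alia.
        by move: ij; rewrite ltnS leq_eqVlt => /predU1P[E|//]; rewrite -Ei E in ne.
      rewrite eqb0 negbK; split.
        case/orP=> [|jm]; last by exists j.
        by rewrite -E => /(HCp _ Nt)[i [ij im Ei]]; exists i; split=> //; alia.
      move=> [i [ij im Ei]]; move: ij; rewrite ltnS leq_eqVlt => /predU1P[Eij|ij].
        by rewrite -Eij im orbT.
      by apply/orP; left; rewrite -E; apply/HCp => //; exists i.
    * case: (ids t =P _) => [/(ids_inj Nt Nr) E|ne]; last first.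
        rewrite HCi //; split=> -[p [pj pm fp Ep]]; exists p; split=> //; first alia.
        have : p != j.+1 by apply/eqP => Ej; rewrite -Ep Ej in ne.
        by move: pj; alia.
      rewrite eqb0 negbK; split.
        case/orP=> [|/andP[jm fj]]; last by exists j.+1; split=> //; alia.
        by rewrite -E => /(HCi _ Nt)[p [pj pm fp Ep]]; exists p; split=> //; alia.
      move=> [p [pj pm fp Ep]]; case: (eqVneq p j.+1) => [Eij|pj'].
        by rewrite -Eij pm fp orbT.
      by apply/orP; left; rewrite -E; apply/HCi => //; exists p; split=> //; alia.
- move=> s' k' [Fr Fa] [kN HT' HC' Hk'].
  rewrite !evalE (Fr rN isT) EN => /eqP; rewrite eqb0 -leqNgt => kN'.
  split; first alia.
  have Ek : reg s' rk = N by alia.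
  by rewrite Ek in HT' HC'; apply: wp_nil; split=> //; alia.
Qed.

(** * Images in the text; failure and dictionary links *)

Variable imgs : seq (seq A).
Hypotheses (imgs_uniq : uniq imgs) (imgs_nil : [::] \notin imgs).
Hypothesis imgsP : forall v,
  v \in imgs <-> exists p, [/\ 0 < p, p <= m, fs p & pref p = v].
Hypothesis ppP : forall v, is_pp imgs v <-> exists i, i < m /\ par i = v.

Local Notation fail := (fail T fs N).
Local Notation dl := (dl imgs).
Local Notation w := (pref N).

Definition tables s :=
  [/\ env s, forall i, i < N -> arr s aT i = code (T i),
      forall t i, node t -> i < N -> arr s aChild (ids t * N.+1 + code (T i)) =
        if node (rcons t (T i)) then ids (rcons t (T i)) else 0,
      forall p, p <= N -> arr s aNd p = ids (pref p) /\ arr s aDep p = size (pref p) &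
      forall t, node t ->
        (arr s aPp (ids t) != 0) = is_pp imgs t /\
        (arr s aImg (ids t) != 0) = (t \in imgs)].

Lemma tables_intro s : env s -> trie_inv N s -> class_inv N s -> tables s.
Proof.
move=> He [HT _ HC HN] [Hp Hi]; split=> //.
  by move=> i iN; rewrite HT // iN.
move=> t Nt; split; apply/idP/idP.
- by move/Hp => /(_ Nt) [i [_ im E]]; apply/ppP; exists i.
- by move/ppP => [i [im E]]; apply/Hp => //; exists i; split=> //; lia.
- by move/Hi => /(_ Nt) [p [/andP[p0 _] pm f E]]; apply/imgsP; exists p.
- by move/imgsP => [p [p0 pm f E]]; apply/Hi => //; exists p; split=> //; lia.
Qed.

Lemma tables_frame p s s' : tables s -> frame p s s' ->
  all (fun x => x \notin prog_regs p) [:: rM; rN; rK] ->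
  all (fun a => a \notin prog_arrs p) [:: aT; aFs; aChild; aNd; aDep; aPp; aImg] ->
  tables s'.
Proof.
move=> [[E1 E2 E3 E4] H1 H2 H3 H4] [Fr Fa] /= /and4P[? ? ? _].
move=> /and5P[? ? ? ? /and4P[? ? ? _]].
by split; [split|..]; do ?[rewrite Fr // | rewrite Fa //].
Qed.

Lemma pref_neq0 k : pref k.+1 != [::].
Proof. by rewrite prefS; case: (par k). Qed.

(** Kept per position; the entry of a node [x] is the one at [ids x], as [pref (ids x) = x]. *)
Definition fail_inv s p :=
  [/\ arr s aF p = ids (fail (pref p)), arr s aDl p = ids (dl (pref p)) &
      (arr s aHw p != 0) = suffix w (pref p)].

Lemma dl_node p : p <= N -> node (dl (pref p)).
Proof.
move=> pN; have /orP[/imgsP[q [_ qm _ <-]]|/eqP->] := dl_or imgs (pref p).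
  by apply: node_pref; lia.
exact: node_nil.
Qed.

Lemma img_node v : v \in imgs -> node v.
Proof. by move=> /imgsP[q [_ qm _ <-]]; apply: node_pref; lia. Qed.

Lemma ids_lt t : node t -> ids t < N.+2 * N.+2.
Proof. by move=> Ht; have : ids t <= N := Ht; nia. Qed.

Lemma eval_child s x k : tables s -> node x -> k < N -> reg s rx = ids x ->
  reg s rk = k ->
  eval W s child_cell = if node (rcons x (T k)) then ids (rcons x (T k)) else 0.
Proof.
move=> [[_ _ EK _] HL HC _ _] Nx kN Ex Ek; have := code_le kN => Hc.
have Nx' : ids x <= N := Nx.
rewrite /child_cell !evalE Ex Ek EK HL // (small (_ * _)) ?small ?HC //; nia.
Qed.

Lemma eval_child_cond s x k : tables s -> node x -> k < N -> reg s rx = ids x ->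
  reg s rk = k ->
  eval W s (AndE (NotE child_cell) (Reg rx)) = ~~ node (rcons x (T k)) && (x != [::]).
Proof.
move=> HT Nx kN Ex Ek; rewrite (eval_and HW) eval_not (eval_child HT Nx kN) // eval_reg Ex.
rewrite ids_eq0 // eqb0; case: ifPn => H; last by rewrite eqxx.
by rewrite ids_eq0 //; case: (x).
Qed.

Lemma fail_ok s k k1 : tables s ->
  reg s rh = 0 -> (exists2 q, size q = reg s rt &
     (forall i, i < size q -> arr s aQ i = nth 0 q i) /\ queue_inv T fs N q 0) ->
  fail_inv s 0 -> 60 * N + 1 + k1 <= k ->
  wp W fail_loop
    (fun s' k' => (forall p, p <= N -> fail_inv s' p) /\ k1 <= k') s k.
Proof.
move=> HT E0 [q0 E1 [E2 Hq0]] F0 Hk.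
(* The amortized cost of the extracted positions; [tot - c q h] is what remains, backed by 30
   credits per unit. *)
pose c q h := \sum_(j <- take h q) cost T fs N j.
pose tot := \sum_(j <- iota 0 N) cost T fs N j.
have c_le q h : queue_inv T fs N q h -> c q h <= tot.
  move=> [q1 q2 _ _ _]; rewrite /c /tot.
  apply: (@uniq_sub_le_big _ addn leq leqnn (fun x y => leq_addr y x)).
  - by rewrite take_uniq.
  - exact: iota_uniq.
  - by move=> j /mem_take/q2; rewrite mem_iota.
have tot_le : tot <= 2 * N by apply: sum_cost.
apply: (@wp_while W (fun s k => exists q h,
  [/\ reg s rh = h, reg s rt = size q /\ h <= size q,
      (forall i, i < size q -> arr s aQ i = nth 0 q i) /\ queue_inv T fs N q h,
      fail_inv s 0 /\ (forall j, j \in take h q -> fail_inv s j.+1) &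
      30 * (tot - c q h) + 1 + k1 <= k])).
- exists q0, 0; split=> //; first by split=> //; rewrite take0.
  by rewrite /c take0 big_nil; alia.
- move=> {F0 E0 Hk E1 E2 Hq0 q0 k}s1 k' Ff [q [h [Eh [Et hq] [Hq Hqi] [F0 HF] Hk]]].
  have := tables_frame HT Ff isT isT => {HT Ff s}.
  move: s1 Eh Et Hq F0 HF => s Eh Et Hq F0 HF HT.
  rewrite !evalE Eh Et eqb0 negbK => hq'.
  have [[EM EN EK EF] HL HC HN HI] := HT.
  have [q1 q2 q3 q4 q5] := Hqi.
  have qS := queue_step fs0 fsN Hqi hq'; have c_le' := c_le _ _ qS.
  set k := nth 0 q h in qS c_le'.
  have kN : k < N by apply: q2; apply: mem_nth.
  have Etake : take h.+1 (if fs k.+1 then q else rcons q k.+1) = rcons (take h q) k.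
    by case: ifP => _; rewrite -?cats1 ?takel_cat // (take_nth 0) // cats1.
  have Ec : c (if fs k.+1 then q else rcons q k.+1) h.+1 = c q h + cost T fs N k.
    by rewrite /c Etake -cats1 big_cat big_seq1.
  have [rest Erest Hend] : exists2 rest, tot - c q h = cost T fs N k + rest &
      tot - c (if fs k.+1 then q else rcons q k.+1) h.+1 = rest.
    rewrite Ec in c_le' *; exists (tot - (c q h + cost T fs N k)) => //.
    by move: (c q h) (cost T fs N k) c_le' => x y; alia.
  rewrite Erest in Hk; move: (rest) Hk Hend => {Erest Ec c_le' tot_le c_le}rest Hk Hend.
  have Cost := @costE _ T fs N fs0 k; have Hr := @size_fail_prefS _ T fs N fs0 k.
  have szq : size q <= N.
    by rewrite -(size_iota 0 N); apply: uniq_leq_size => // j /q2; rewrite mem_iota.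
  (* The point of the breadth-first order: all shallower positions, hence all nodes visited by the
     search, already have their entries. *)
  have HFp p : p <= N -> size (pref p) < size (pref k.+1) -> fail_inv s p.
    by case: p => // p pN lt; apply: HF; apply: (queue_before fs0 Hqi).
  have Ea : arr s aT k = code (T k) by apply: HL.
  have := code_le kN => Hcode.
  have size_Hx x : (if fs k then x = [::] else
      lsuf node (rcons x (T k)) = fail (pref k.+1)) -> size (fail (pref k.+1)) <= (size x).+1.
    case: ifP => Hf; first by rewrite fail_prefS // Hf.
    by move=> <-; rewrite -(size_rcons x (T k)); apply: size_suffix (lsuf_suffix _ _).
  have [|K EK'] := @credits 30 k'; first by alia.
  rewrite {}EK' in Hk *; split=> //.
  apply: (wp_let (v := k)); [by rewrite !evalE Eh Hq|].
  apply: (wp_let (v := h.+1)).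
    by rewrite !evalE /= /upd /= Eh small ?addn1 //; ania.
  apply: (wp_let (v := ids (fail (par k)))).
    apply: eval_ite; last by apply: ids_lt; apply: fail_node.
    rewrite !evalE /= /upd /= EF ?eqb0 ?negbK; last alia.
    rewrite /par; case: ifPn => Hf; first by rewrite fail_nil ids_nil.
    have [] // : fail_inv s k by apply: HFp; [alia|rewrite prefS /par (negbTE Hf) size_rcons].
  (* [x] is the candidate for the failure link without its last letter; each failure step shortens
     it and costs 2 credits. *)
  apply: (wp_while (I := fun s2 k2 => exists x, [/\ node x, reg s2 rx = ids x,
    size x < size (pref k.+1) /\ size x <= size (fail (par k)), if fs k then x = [::] else
      lsuf node (rcons x (T k)) = fail (pref k.+1) &
      30 + K + 2 * size x <= k2 + 2 * size (fail (par k)) + 4])).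
  - exists (fail (par k)); split=> //.
    + exact: fail_node.
    + split=> //; rewrite prefS size_rcons ltnS; apply: size_suffix; exact: fail_suffix.
    + by rewrite fail_prefS // /par; case: (fs k) => //; apply: fail_nil.
    + alia.
  - move=> s2 k2 [Fr Fa] [x [Nx Ex [szx szx0] Hx Hk2]].
    have szr : size (fail (pref k.+1)) <= (size x).+1 by apply: size_Hx.
    have HT2 : tables s2.
      have HT1 : tables (set_reg (set_reg (set_reg s 6 k) 9 h.+1) 7 (ids (fail (par k)))) := HT.
      exact: tables_frame HT1 (Frame Fr Fa) isT isT.
    have Ek2 : reg s2 rk = k by rewrite (Fr rk isT).
    rewrite (eval_child_cond HT2 Nx kN) // eqb0 negbK => /andP[Hn x0].
    have [EF2 _ _] : fail_inv s (ids x).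
      by apply: HFp; [exact: Nx|rewrite pref_ids].
    have [|K2 EK2] := @credits 2 k2; first by alia.
    rewrite {}EK2 in Hk2 *; split=> //.
    apply: (wp_let (v := ids (fail x))).
      by rewrite !evalE Ex (Fa aF isT) /= EF2 pref_ids.
    apply: wp_nil; exists (fail x); have := fail_size T fs N x0 => fx.
    split=> //; [exact: fail_node|split; alia| |alia].
    move: Hx; case: (fs k) => [E|]; first by rewrite E in x0.
    by rewrite lsuf_node_step.
  - move=> s2 k2 [Fr Fa] [x [Nx Ex [szx szx0] Hx Hk2]].
    have szr : size (fail (pref k.+1)) <= (size x).+1 by apply: size_Hx.
    have HT2 : tables s2.
      have HT1 : tables (set_reg (set_reg (set_reg s 6 k) 9 h.+1) 7 (ids (fail (par k)))) := HT.
      exact: tables_frame HT1 (Frame Fr Fa) isT isT.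
    have Ek2 : reg s2 rk = k by rewrite (Fr rk isT).
    rewrite (eval_child_cond HT2 Nx kN) // => /eqP; rewrite eqb0 negb_and !negbK => Hcond.
    pose r := fail (pref k.+1).
    have Er : r = if fs k then [::] else if node (rcons x (T k)) then rcons x (T k) else [::].
      rewrite /r; move: Hx; case: ifPn => Hf.
        by rewrite fail_prefS // Hf.
      move=> <-; case: ifPn => Hn; first exact: lsuf_id.
      move: Hcond; rewrite (negbTE Hn) /= => /eqP x0.
      by rewrite (lsuf_behead Hn) x0 lsuf_nil.
    have Nr : node r by apply: fail_node.
    have rlt : size r < size (pref k.+1) by apply: fail_size; apply: pref_neq0.
    have [EM2 EN2 EKK2 EF2] : env s2 by case: HT2.
    have [_ _ _ HN2 HI2] := HT2.
    have kB : k.+2 < N.+2 * N.+2 by ania.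
    rewrite -/r in Cost szr.
    have [|K2 EK2] := @credits 10 k2; first by alia.
    rewrite {}EK2 in Hk2 *; split=> //.
    apply: (wp_let (v := ids r)).
      apply: eval_ite; last exact: ids_lt.
      rewrite (eval_child HT2 Nx kN) // !evalE Ek2 EF2 ?eqb0 ?negbK; last alia.
      by rewrite Er; case: (fs k) => /=; rewrite ?ids_nil //; case: ifP; rewrite ?ids_nil.
    apply: (wp_let (v := k.+1)).
      by rewrite !evalE /= /upd /= Ek2 small ?addn1 //; alia.
    apply: (wp_set (j := k.+1) (v := ids r)); [by []|by []|].
    have [F1 F2 F3] : fail_inv s (ids r).
      by apply: HFp; [exact: Nr|rewrite pref_ids].
    (* Images are nodes, so the longest image that is a proper suffix is a suffix of the failure
       link [r]. *)
    have Edl : dl (pref k.+1) = if r \in imgs then r else dl r.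
      rewrite /dl /r /fail -(lsuf_lsuf (r := node)); last exact: img_node.
      by case: ifPn => H; [apply: lsuf_id|apply: lsuf_behead].
    apply: (wp_set (j := k.+1) (v := ids (dl (pref k.+1)))); [by []| |].
      apply: eval_ite; last by apply: ids_lt; apply: dl_node.
      rewrite !evalE /= /upd /= (HI2 r Nr).2 Edl; case: ifP => // _.
      by rewrite (Fa aDl isT) /= F2 pref_ids.
    apply: (wp_set (j := k.+1) (v := suffix w (pref k.+1))); [by []| |].
      (* As [w] is a node, it is a proper suffix of the current prefix exactly if it is a suffix of
         the failure link. *)
      rewrite !evalE /= /upd /= EN2 (HN2 N _).1 // (HN2 k.+1 kN).1 (Fa aHw isT) /= F3.
      rewrite pref_ids // eqb0 negbK; congr (nat_of_bool _); apply/orP/idP.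
        case=> [/eqP/ids_inj->|H]; try exact: node_pref; first exact: suffix_refl.
        exact: suffix_trans H (fail_suffix _ _ _ _).
      case: (eqVneq w (pref k.+1)) => [-> _|ne H]; [by left; rewrite eqxx|right].
      by apply: fail_max; rewrite // node_pref.
    have Et2 : reg s2 rt = size q by rewrite (Fr rt isT) /= /upd /= Et.
    apply: (wp_set (j := size q) (v := k.+1)); [by rewrite !evalE /= /upd /= Et2|by []|].
    apply: (wp_let (v := size q + ~~ fs k.+1)).
      rewrite !evalE /= /upd /= Et2 EF2 // eqb0 small //.
      by case: (fs _); ania.
    apply: wp_nil; exists (if fs k.+1 then q else rcons q k.+1), h.+1.
    split=> /=; rewrite /upd /=.
    + by rewrite (Fr rh isT).
    + by case: (fs k.+1); rewrite ?size_rcons; split; alia.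
    + split; last exact: qS.
      move=> i iq; rewrite (Fa aQ isT) /=.
      move: iq; case: (fs k.+1); rewrite ?size_rcons => iq.
        by rewrite (ltn_eqF iq) Hq.
      rewrite nth_rcons; move: iq; rewrite ltnS leq_eqVlt => /predU1P[->|iq].
        by rewrite eqxx ltnn.
      by rewrite (ltn_eqF iq) iq Hq.
    + have Hj j : j != k.+1 -> fail_inv s j -> fail_inv (set_reg (set_arr (set_arr
        (set_arr (set_arr (set_reg (set_reg s2 7 (ids r)) 6 k.+1) 11 k.+1 (ids r))
        12 k.+1 (ids (dl (pref k.+1)))) 13 k.+1 (suffix w (pref k.+1))) 3 (size q) k.+1)
        10 (size q + ~~ fs k.+1)) j.
        move=> /negbTE ne [G1 G2 G3]; split; rewrite /= /upd /= ne.
        - by rewrite (Fa aF isT).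
        - by rewrite (Fa aDl isT).
        - by rewrite (Fa aHw isT).
      split; first exact: Hj.
      move=> j; rewrite Etake mem_rcons inE => /predU1P[->|jh].
        by split; rewrite /= /upd /= eqxx // eqb0 negbK.
      apply: Hj; last exact: HF.
      rewrite eqSS; apply: contraTneq jh => ->.
      by have := take_uniq h.+1 q1; rewrite (take_nth 0) // rcons_uniq => /andP[].
    + by rewrite Hend; alia.
- move=> s1 k' Ff [q [h [Eh [Et hq] [Hq Hqi] [F0' HF] Hk']]].
  rewrite !evalE Eh Et => /eqP; rewrite eqb0 -leqNgt => qh.
  have Eq : h = size q by alia.
  split; first alia.
  apply: wp_nil; split; last alia.
  case=> // p pN; apply: HF; rewrite Eq take_size.
  by rewrite Eq in Hqi; apply: (queue_end fs0 Hqi).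
Qed.

(** * Marks on the proper suffixes of images *)

Definition marked k t := (t == [::]) || has (fun p => fs p && psuf t (pref p)) (iota 1 k).

Lemma markedS k t : marked k.+1 t = marked k t || fs k.+1 && psuf t (pref k.+1).
Proof. by rewrite /marked -[k.+1]addn1 iotaD has_cat /= orbF !addn1 add1n orbA. Qed.

Lemma psuf_trans (t x v : seq A) : suffix t x -> psuf x v -> psuf t v.
Proof.
move=> tx /andP[xv ne]; rewrite /psuf (suffix_trans tx xv) /=.
apply: contraNneq ne => E; rewrite -E in xv *; apply/eqP.
by apply: suffix_size_eq xv _; apply: size_suffix.
Qed.

(** Closure under suffixes is why a walk may stop at the first marked node. *)
Lemma marked_suffix k t x : suffix t x -> marked k x -> marked k t.
Proof.
move=> tx /orP[/eqP x0|/hasP[p Hp /andP[f Hx]]]; first by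
  rewrite x0 suffixs0 in tx; rewrite /marked tx.
by apply/orP; right; apply/hasP; exists p; rewrite // f (psuf_trans tx).
Qed.

Lemma psuf_fail t v : node t -> v != [::] -> psuf t v = suffix t (fail v).
Proof.
move=> Nt v0; apply/idP/idP => [/andP[H1 H2]|H]; first exact: fail_max.
apply: psuf_trans H _; rewrite /psuf fail_suffix.
by apply: contraTneq (fail_size T fs N v0) => ->; rewrite ltnn.
Qed.

Lemma marked_m t : marked m t = (t == [::]) || is_start imgs t (size t).
Proof.
rewrite /is_start take_size; congr (_ || _); apply/hasP/hasP.
- move=> [p]; rewrite mem_iota => Hp /andP[f H]; exists (pref p) => //.
  by apply/imgsP; exists p; split=> //; lia.
- move=> [v /imgsP[p [p0 pm f <-]] H]; exists p; last by rewrite f.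
  by rewrite mem_iota; lia.
Qed.

(** The potential of the marking phase: each inner iteration lowers it by one. *)
Definition unmarked s := \sum_(p < N.+1) (arr s aMk p == 0).

Lemma unmarked_set s p : p <= N -> arr s aMk p = 0 ->
  unmarked s = (unmarked (set_arr s aMk p 1)).+1.
Proof.
move=> pN E; pose o := Ordinal (pN : p < N.+1).
rewrite /unmarked (bigD1 o) //= [in RHS](bigD1 o) //= E /upd /= !eqxx add0n add1n.
by congr _.+1; apply: eq_bigr => i; rewrite -val_eqE /= => /negbTE ->.
Qed.

Lemma mark_ok s k k1 : tables s -> (forall p, p <= N -> fail_inv s p) ->
  (forall p, p <= N -> arr s aMk p = 0) -> 12 * N + 10 + k1 <= k ->
  wp W mark_loop (fun s' k' =>
    (forall t, node t -> (arr s' aMk (ids t) != 0) = marked m t) /\ k1 <= k') s k.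
Proof.
move=> HT HF HM Hk; have [K EK] := credits Hk; rewrite {}EK in Hk *.
have -> : 12 * N + 10 + k1 + K = (9 + 12 * N + k1 + K).+1 by lia.
apply: (wp_set (j := 0) (v := 1)); [by rewrite !evalE|by rewrite !evalE|].
have -> : 9 + 12 * N + k1 + K = (8 + 12 * N + k1 + K).+1 by lia.
apply: (wp_let (v := 0)); first by rewrite !evalE.
apply: (@wp_while W (fun s k => [/\ reg s rk <= m,
  forall t, node t -> (arr s aMk (ids t) != 0) = marked (reg s rk) t &
  3 * unmarked s + 5 * (m - reg s rk) + 1 + k1 <= k])).
- split=> //=.
    move=> t Nt; rewrite /upd /= ids_eq0 // /marked /= orbF.
    by case: (t =P [::]) => // _; rewrite HM; [|exact: Nt].
  set U := unmarked _; suff : U <= N.+1 by alia.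
  apply: leq_trans (_ : \sum_(p < N.+1) 1 <= _); last by rewrite sum_nat_const card_ord muln1.
  by apply: leq_sum => i _; apply: leq_b1.
- move=> {Hk K k}s1 k' Ff [km HMk Hk'].
  have HT1 : tables (set_reg (set_arr s aMk 0 1) rk 0) := HT.
  have := tables_frame HT1 Ff isT isT.
  have : forall p, p <= N -> fail_inv s1 p.
    by move=> p pN; have [? ? ?] := HF p pN; case: Ff => _ Fa; split; rewrite Fa.
  move=> {Ff HF HT HT1 HM s}; move: s1 km HMk Hk' => s; set k := reg s rk.
  move=> km HM Hk HF HT; have [[EM EN EK EF] _ _ _ _] := HT.
  rewrite !evalE -/k EM eqb0 negbK => ltk.
  have [|K EKK] := @credits 4 k'; first by alia.
  rewrite {}EKK in Hk *; split=> //.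
  have kN : k < N by apply: leq_trans mN; apply: ltnW.
  pose x0 := if fs k.+1 then fail (pref k.+1) else [::].
  have Nx0 : node x0 by rewrite /x0; case: ifP => _; [exact: fail_node|exact: node_nil].
  apply: (wp_let (v := k.+1)); first by rewrite !evalE -/k small ?addn1 //; ania.
  apply: (wp_let (v := ids x0)).
    apply: eval_ite; last exact: ids_lt.
    rewrite !evalE /= /upd /= EF // eqb0 negbK /x0.
    by case: ifP; rewrite ?ids_nil //; have [] := HF k.+1 kN.
  (* The walk has so far marked the node suffixes of [x0] longer than [x]. *)
  apply: (wp_while (I := fun s2 k2 => exists x, [/\ node x, reg s2 rx = ids x,
    suffix x x0, forall t, node t -> (arr s2 aMk (ids t) != 0) =
      marked k t || suffix t x0 && (size x < size t) &
    3 * unmarked s2 + 5 * (m - k.+1) + 2 + k1 <= k2])).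
  + exists x0; split=> //; first exact: suffix_refl.
      move=> t Nt; rewrite /= HM // [suffix t x0 && _](_ : _ = false) ?orbF //.
      by apply/negP => /andP[/size_suffix]; rewrite leqNgt => /negbTE->.
    by move: Hk; rewrite /unmarked /=; alia.
  + move=> s2 k2 [Fr Fa] [x [Nx Ex xx0 HM2 Hk2]].
    rewrite !evalE Ex eqb0 negbK => /eqP Hx.
    have Eu := unmarked_set Nx Hx.
    have [|K2 EK2] := @credits 3 k2; first by rewrite Eu in Hk2; alia.
    rewrite {}EK2 Eu in Hk2 *; split=> //.
    apply: (wp_set (j := ids x) (v := 1)); [by rewrite !evalE|by rewrite !evalE|].
    have xn0 : x != [::].
      by apply/eqP => x0'; have := HM2 x Nx; rewrite Hx x0' /marked eqxx.
    apply: (wp_let (v := ids (fail x))).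
      rewrite !evalE /= Ex /upd /= (Fa aF isT) /=.
      by have [-> _ _] := HF (ids x) Nx; rewrite pref_ids.
    apply: wp_nil; exists (fail x); split=> //.
    * exact: fail_node.
    * exact: suffix_trans (fail_suffix _ _ _ _) xx0.
    * move=> t Nt; rewrite /= /upd /=; case: (ids t =P _) => [/ids_inj E|ne].
        by rewrite E // xx0 fail_size // orbT.
      rewrite HM2 //; congr (_ || _); case: (boolP (suffix t x0)) => //= tx0.
      have flt := fail_size T fs N xn0.
      apply/idP/idP => [|H]; first exact: ltn_trans.
      (* A node that is a suffix of [x0], no longer than [x] and different from it, is a suffix of
         [fail x]. *)
      rewrite ltnNge; apply/negP => tx; have tx' := suffix_total tx0 xx0 tx.
      have : suffix t (fail x) by apply: fail_max => //; apply/eqP => E; rewrite E in ne.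
      by move/size_suffix; rewrite leqNgt H.
    * by move: Hk2; rewrite /unmarked /=; alia.
  + move=> s2 k2 [Fr Fa] [x [Nx Ex xx0 HM2 Hk2]].
    rewrite !evalE Ex => /eqP; rewrite eqb0 => Hx.
    split; first alia.
    have Ek2 : reg s2 rk = k.+1 by rewrite (Fr rk isT).
    apply: wp_nil; rewrite Ek2; split=> //; last by alia.
    move=> t Nt; rewrite HM2 // markedS.
    (* [x] is not longer than itself, so its mark predates the walk; by closure all shorter suffixes
       of [x0] were marked before, too. *)
    have Mx : marked k x.
      by have := HM2 x Nx; rewrite Hx ltnn andbF orbF => <-.
    move: (xx0); rewrite /x0; case: (fs k.+1) => /= xx.
      rewrite psuf_fail ?pref_neq0 //; case: (boolP (suffix t _)) => //= tx0.
      case: ltnP => [//|tx]; rewrite orbT orbF; apply: marked_suffix Mx.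
      exact: suffix_total tx0 xx tx.
    by rewrite suffixs0; case: eqP => [->|].
- move=> s1 k' [Fr Fa] [km HMk Hk'].
  rewrite !evalE (Fr rM isT) /= /upd /=; case: HT => [[EM _ _ _] _ _ _ _].
  rewrite EM => /eqP; rewrite eqb0 -leqNgt => mk.
  have Ek : reg s1 rk = m by apply/eqP; rewrite eqn_leq km.
  split; first alia.
  by rewrite Ek in HMk; apply: wp_nil; split=> //; alia.
Qed.

(** * Reachability on the positions of [w] *)

Lemma size_pref_w p : m < p <= N -> size (pref p) = p - m.
Proof.
elim: p => [|p IH] //; rewrite ltnS prefS size_rcons /par => /andP[mp pN].
case: (eqVneq m p) => [<-|ne]; first by rewrite fsm /=; lia.
have mp' : m < p by rewrite ltn_neqAle ne.
rewrite ifN ?IH; [lia|by rewrite mp' ltnW|by apply: fs_w; rewrite mp'].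
Qed.

Lemma size_w : size w = N - m.
Proof. by rewrite size_pref_w // mN leqnn. Qed.

(** Position [m] is excluded: [pref m] is the last image, not the empty prefix of [w]. *)
Lemma take_w p : m < p <= N -> take (p - m) w = pref p.
Proof.
move=> /andP[mp pN]; suff H M : M <= N -> p <= M -> take (p - m) (pref M) = pref p.
  exact: H.
elim: M => [|M IH] MN pM; first by move: (leq_trans mp pM).
move: pM; rewrite leq_eqVlt => /predU1P[E|pM].
  by rewrite E -(size_pref_w (p := M.+1)) ?take_size // -E mp.
have mM : m < M by lia.
rewrite prefS /par ifN; last by apply: fs_w; rewrite mM.
rewrite -cats1 takel_cat ?IH //; [lia|].
by rewrite size_pref_w; lia.
Qed.

(** As [reach 2] implies [reach 1], the largest rank encodes both, and edges are merged by a
    maximum. *)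
Definition reach_inv s p := arr s aR p <= 2 /\
  forall b, 0 < b <= 2 -> (b <= arr s aR p) <-> reach imgs w b (p - m).

Lemma reach_ok s k k1 : tables s -> (forall p, p <= N -> fail_inv s p) ->
  (forall t, node t -> (arr s aMk (ids t) != 0) = marked m t) ->
  12 * N + 10 + 4 * (\sum_(m.+1 <= p < N.+1) cnt imgs (pref p)) + k1 <= k ->
  wp W reach_loop (fun s' k' =>
    (forall p, m <= p <= N -> reach_inv s' p) /\ k1 <= k') s k.
Proof.
move=> HT HF HM Hk; pose pot k := \sum_(k.+1 <= p < N.+1) cnt imgs (pref p).
have [[EM EN EK EF] _ _ _ _] := HT.
have [|K EKK] := @credits 2 k; first by alia.
rewrite {}EKK in Hk *.
apply: (wp_set (j := m) (v := 1)); [by rewrite !evalE|by rewrite !evalE|].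
apply: (wp_let (v := m)); first by rewrite !evalE.
apply: (@wp_while W (fun s k => [/\ m <= reg s rk <= N,
  forall p, m <= p <= reg s rk -> reach_inv s p &
  9 * (N - reg s rk) + 4 * pot (reg s rk) + 1 + k1 <= k])).
- split=> /=; first by rewrite leqnn ltnW.
    move=> p; rewrite /upd /= => pm; have -> : p = m by alia.
    rewrite /reach_inv /= /upd /= eqxx subnn; split=> // b Hb; split=> [b1|].
      exists 0; split=> //; rewrite take0; exact: imgf_nil.
    by move=> [i [i0 Hi _]]; move: i0 Hi; rewrite leqn0 => /eqP->.
  by move: Hk; rewrite /pot /upd /=; set S := \sum_(_ <= _ < _) _; alia.
- move=> s1 k' Ff [km HR Hk'].
  have HT1 : tables (set_reg (set_arr s aR m 1) rk m) := HT.
  have := tables_frame HT1 Ff isT isT.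
  have : forall p, p <= N -> fail_inv s1 p.
    by move=> p pN; have [? ? ?] := HF p pN; case: Ff => _ Fa; split; rewrite Fa.
  have : forall t, node t -> (arr s1 aMk (ids t) != 0) = marked m t.
    by move=> t Nt; rewrite -HM //; case: Ff => _ Fa; rewrite Fa.
  move=> {Ff HF HT HT1 HM EM EN EK EF Hk K s k}; move: s1 km HR Hk' => s; set k := reg s rk.
  move=> km HR Hk HM HF HT; have [[EM EN EK EF] _ _ HN HI] := HT.
  rewrite !evalE -/k EN eqb0 negbK => ltk.
  have Epot : pot k = cnt imgs (pref k.+1) + pot k.+1 by rewrite /pot big_ltn.
  have [|K EKK] := @credits 7 k'; first by alia.
  rewrite {}EKK Epot in Hk *; split=> //.
  have Nk : node (pref k.+1) by apply: node_pref.
  have Ntake : take (k.+1 - m) w = pref k.+1 by apply: take_w; alia.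
  pose j := k.+1 - m; have j0 : j == 0 = false by rewrite /j; alia.
  have jw : j <= size w by rewrite size_w /j; alia.
  pose i0 := init imgs w j.
  have Ei0 : i0 = if marked m (pref k.+1) then 2 else 0.
    rewrite /i0 /init j0 marked_m (negbTE (pref_neq0 _)) /=.
    by rewrite /is_start Ntake take_size.
  apply: (wp_let (v := k.+1)); first by rewrite !evalE -/k small ?addn1 //; ania.
  apply: (wp_let (v := ids (pref k.+1))); first by rewrite !evalE /= /upd /= (HN _ ltk).1.
  apply: (wp_set (j := k.+1) (v := i0)); first by rewrite !evalE.
    apply: eval_ite; last by rewrite Ei0; case: ifP; ania.
    by rewrite !evalE /= /upd /= HM // Ei0 (small2 HW).
  pose y0 := lsuf (mem imgs) (pref k.+1).
  have Ny0 : node y0.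
    rewrite /y0; case/orP: (lsuf_or (mem imgs) (pref k.+1)) => [/img_node//|/eqP->].
    exact: node_nil.
  apply: (wp_let (v := ids y0)).
    apply: eval_ite; last exact: ids_lt.
    rewrite !evalE /= /upd /= (HI _ Nk).2 /y0; have [_ E _] := HF _ Nk.
    rewrite E pref_ids //; case: ifPn => H; first by rewrite lsuf_id.
    by rewrite [in RHS]lsuf_behead.
  (* The edges of the images longer than [y] have been merged; [4 * cnt imgs y] credits pay for the
     rest of the chain. *)
  apply: (wp_while (I := fun s2 k2 => exists y, [/\ (y \in imgs) || (y == [::]),
    suffix y (pref k.+1) /\ reg s2 rx = ids y,
    arr s2 aR k.+1 <= 2 /\ (forall p, p <= k -> arr s2 aR p = arr s aR p),
    forall b, 0 < b <= 2 -> (b <= arr s2 aR k.+1) <-> b <= i0 \/ exists v,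
      [/\ v \in imgs, suffix v (pref k.+1), size y < size v & reach imgs w b (j - size v)] &
    4 * cnt imgs y + 9 * (N - k.+1) + 4 * pot k.+1 + 2 + k1 <= k2])).
  + exists y0; split.
    * exact: (lsuf_or (mem imgs)).
    * by split; [exact: lsuf_suffix|].
    * split; rewrite /= /upd /= ?eqxx ?Ei0; first by case: ifP.
      by move=> p pk; rewrite ltn_eqF.
    * move=> b Hb; rewrite /= /upd /= eqxx; split; first by left.
      case=> // -[v [Hv vs yv _]]; have := lsuf_max (q := mem imgs) vs Hv.
      by move/size_suffix; rewrite -/y0 leqNgt yv.
    * by rewrite /y0 cnt_lsuf; move: Hk; alia.
  + move=> s2 k2 Ff2 [y [Hy [ys Ey] [R2 Rk] HR2 Hk2]].
    have Ny : node y by case/orP: Hy => [/img_node|/eqP->] //; apply: node_nil.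
    rewrite !evalE Ey ids_eq0 // => y0'; rewrite (negbTE y0') orbF in Hy.
    rewrite (cnt_dl imgs_nil imgs_uniq Hy) in Hk2.
    have [|K2 EK2] := @credits 4 k2; first by alia.
    rewrite {}EK2 in Hk2 *; split=> //.
    have [[_ _ _ _] _ _ HN2 _] : tables s2.
      have HT1 : tables (set_reg (set_arr (set_reg (set_reg s 6 k.+1) 7 (ids (pref k.+1)))
        15 k.+1 i0) 7 (ids y0)) := HT.
      exact: tables_frame HT1 Ff2 isT isT.
    have [Fr2 Fa2] := Ff2.
    have yj : size y <= j.
      by apply: leq_trans (size_suffix ys) _; rewrite size_pref_w ?/j //; alia.
    have ygt : 0 < size y by rewrite lt0n size_eq0.
    have Eky : k.+1 - size y = m + (j - size y) by rewrite /j; move: yj; rewrite /j; alia.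
    have [Rle HRy] : reach_inv s (k.+1 - size y) by apply: HR; rewrite Eky /j; alia.
    pose r := arr s aR (k.+1 - size y).
    have Er : eval W s2 (Get aR (Sub (Reg rk) (Get aDep (Reg rx)))) = r.
      have Ea : eval W s2 (Reg rk) = k.+1 by rewrite !evalE (Fr2 rk isT).
      have Eb : eval W s2 (Get aDep (Reg rx)) = size y.
        by rewrite !evalE Ey (HN2 _ Ny).2 pref_ids.
      rewrite eval_get eval_sub ?Ea ?Eb; [by rewrite Rk //; alia|by rewrite /j in yj; alia|ania].
    apply: (wp_let (v := r)) => //.
    apply: (wp_set (j := k.+1) (v := maxn (arr s2 aR k.+1) r)).
    * by rewrite !evalE /= /upd /= (Fr2 rk isT).
    * apply: eval_ite; last by rewrite gtn_max; apply/andP; split; rewrite /r; ania.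
      rewrite !evalE /= /upd /= (Fr2 rk isT) /= eqb0 negbK; rewrite /upd /=.
      by case: ltnP.
    apply: (wp_let (v := ids (dl y))).
      rewrite !evalE /= /upd /= Ey (Fa2 aDl isT) /= /upd /=.
      by have [_ -> _] := HF _ Ny; rewrite pref_ids.
    apply: wp_nil; exists (dl y); split.
    * exact: dl_or.
    * by split=> //; apply: suffix_trans (dl_suffix _ _) ys.
    * split; rewrite /= /upd /= ?eqxx; first by rewrite geq_max R2.
      by move=> p pk; rewrite ltn_eqF ?Rk.
    * move=> b Hb; rewrite /= /upd /= eqxx leq_max; split.
        case/orP=> [/(HR2 _ Hb)[|[v [Hv vs yv Hr]]]|]; first by left.
          right; exists v; split=> //; apply: leq_ltn_trans yv.
          exact: size_suffix (dl_suffix _ _).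
        move=> /(HRy _ Hb) Hr; right; exists y; split=> //.
          by rewrite /dl; case: (y) y0' => // a y' _; rewrite ltnS;
            apply: size_suffix; apply: lsuf_suffix.
        by rewrite Eky addKn in Hr.
      case=> [Hb0|[v [Hv vs yv Hr]]]; first by apply/orP; left; apply/HR2 => //; left.
      case: (leqP (size v) (size y)) => [vy|yv'].
        have E := dl_next Hv vs ys yv vy; rewrite E in Hr.
        by apply/orP; right; apply/HRy => //; rewrite Eky addKn.
      by apply/orP; left; apply/HR2 => //; right; exists v.
    * by alia.
  + move=> s2 k2 [Fr2 Fa2] [y [Hy [ys Ey] [R2 Rk] HR2 Hk2]].
    have Ny : node y by case/orP: Hy => [/img_node|/eqP->] //; apply: node_nil.
    rewrite !evalE Ey => /eqP; rewrite ids_eq0 // => /eqP y0'.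
    split; first by alia.
    apply: wp_nil; rewrite (Fr2 rk isT) /= /upd /=; split; [by alia| |by alia].
    move=> p /andP[mp]; rewrite leq_eqVlt => /predU1P[->|pk]; last first.
      by have := HR p; rewrite /reach_inv mp -ltnS pk Rk //; apply.
    split=> // b Hb; rewrite (HR2 _ Hb) -/j; split.
      move=> H; apply/reach_step => //; case: H; first by left.
      by move=> [v [Hv vs _ Hr]]; right; exists v; rewrite /j Ntake.
    move/(reach_step _ _ jw) => [|[v [Hv vs Hr]]]; first by left.
    right; exists v; split=> //; first by rewrite -Ntake.
    by rewrite y0' lt0n size_eq0; apply: contraNneq imgs_nil => <-.
- move=> s1 k' [Fr Fa] [km HR Hk'].
  rewrite !evalE (Fr rN isT) /= /upd /= EN => /eqP; rewrite eqb0 -leqNgt => mk.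
  have Ek : reg s1 rk = N by alia.
  split; first alia.
  by rewrite Ek in HR; apply: wp_nil; split=> //; alia.
Qed.

Lemma end_ok s k k1 : tables s -> (forall p, p <= N -> fail_inv s p) ->
  (forall p, m <= p <= N -> reach_inv s p) -> reg s rBad = 0 ->
  4 * N + 10 + k1 <= k ->
  wp W end_loop (fun s' k' => ((reg s' rBad != 0) <->
     exists t, [/\ suffix t w, is_pp imgs t &
       reach imgs w (if t == [::] then 2 else 1) (size w - size t)]) /\ k1 <= k') s k.
Proof.
move=> HT HF HR Eb Hk; have [[EM EN EK EF] _ _ HN HI] := HT.
pose bad_end t := [/\ suffix t w, is_pp imgs t &
  reach imgs w (if t == [::] then 2 else 1) (size w - size t)].
have [|K EKK] := @credits 2 k; first by alia.
rewrite {}EKK in Hk *.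
have Nw : node w by apply: node_pref.
apply: (wp_let (v := ids w)); first by rewrite !evalE EN (HN _ _).1.
apply: (wp_let (v := 1)); first by rewrite !evalE.
(* The ends longer than [x] have been tested; [ry = 0] says that the root has been, too. *)
apply: (wp_while (I := fun s k => exists x, [/\ node x, suffix x w, reg s rx = ids x,
  (reg s rBad != 0) <->
    exists2 t, bad_end t & (reg s ry == 0) || (size x < size t) &
  (if reg s ry == 0 then 1 else 4 * size x + 5) + k1 <= k])).
- exists w; split=> //; first exact: suffix_refl.
    rewrite /= /upd /= Eb; split=> // -[t [/size_suffix tw _ _]].
    by rewrite ltnNge tw.
  by have := size_pref T fs N; move: Hk; rewrite /= /upd /=; alia.
- move=> s2 k2 [Fr Fa] [x [Nx xw Ex Hb Hk2]].
  rewrite !evalE => ry0; rewrite (negbTE ry0) in Hb Hk2.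
  have [|K2 EK2] := @credits 4 k2; first by alia.
  rewrite {}EK2 in Hk2 *; split=> //.
  have xN : size x <= N - m by rewrite -size_w; apply: size_suffix.
  pose p := N - size x; have pN : m <= p <= N by rewrite /p; alia.
  have [R2 HRp] := HR p pN.
  have Epm : p - m = size w - size x by rewrite /p size_w; alia.
  have Nx' : ids x <= N := Nx.
  have Ec : eval W s2 (OrE (Reg rBad) (AndE (Get aPp (Reg rx))
      (Lt (Const 1) (Add (Get aR (Sub (Reg rN) (Get aDep (Reg rx))))
         (Lt (Const 0) (Reg rx)))))) =
      (reg s2 rBad != 0) || is_pp imgs x && ((if x == [::] then 2 else 1) <= arr s aR p).
    have Ea : eval W s2 (Reg rN) = N by rewrite !evalE (Fr rN isT).
    have Ed : eval W s2 (Get aDep (Reg rx)) = size x.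
      by rewrite !evalE Ex (Fa aDep isT) /= (HN _ Nx').2 pref_ids.
    have Es : eval W s2 (Sub (Reg rN) (Get aDep (Reg rx))) = p.
      by rewrite eval_sub ?Ea ?Ed //; [alia|ania].
    rewrite !evalE Es Ex (Fa aPp isT) (Fa aR isT) /= (HI _ Nx).1 !eqb0 !negbK lt0n ids_eq0 //.
    rewrite small; last by case: (_ != _); ania.
    by case: (x == [::]) => /=; rewrite ?addn0 ?addn1.
  apply: (wp_let Ec).
  apply: (wp_let (v := ids x)); first by rewrite !evalE.
  apply: (wp_let (v := ids (fail x))).
    rewrite !evalE /= /upd /= Ex (Fa aF isT) /=.
    by have [-> _ _] := HF (ids x) Nx'; rewrite pref_ids.
  have Hx : is_pp imgs x && ((if x == [::] then 2 else 1) <= arr s aR p) <-> bad_end x.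
    rewrite /bad_end -Epm; split=> [/andP[H1 H2]|[_ -> H2] /=].
      by split=> //; apply/HRp => //; case: ifP.
    by apply/HRp => //; case: ifP.
  apply: wp_nil; exists (fail x); split=> //.
  + exact: fail_node.
  + exact: suffix_trans (fail_suffix _ _ _ _) xw.
  + rewrite /= /upd /= eqb0 negbK ids_eq0 //; split.
      case/orP=> [/Hb[t Ht /= xt]|/Hx Ht].
        exists t => //; apply/orP; right; apply: leq_ltn_trans xt.
        exact: size_suffix (fail_suffix _ _ _ _).
      exists x => //; case: (eqVneq x [::]) => //= x0; exact: fail_size.
    move=> [t Ht Hs]; apply/orP; case: (ltnP (size x) (size t)) => [xt|tx].
      by left; apply/Hb; exists t.
    right; apply/Hx; have [tw tp _] := Ht; have tx' := suffix_total tw xw tx.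
    case: (eqVneq t x) => [<- //|ne].
    (* Proper prefixes of images are nodes, so the failure chain of [w] misses no end. *)
    have Nt : node t.
      by have /ppP[i [im <-]] := tp; apply: node_par; apply: leq_trans im (ltnW mN).
    have := fail_max tx' ne Nt => /size_suffix tf; move: Hs; rewrite ltnNge tf orbF.
    by move=> /eqP x0; rewrite x0 suffixs0 in tx'; case/eqP: ne; rewrite x0; apply/eqP.
  + rewrite /= /upd /= ids_eq0 //; case: eqP => [x0|/eqP x0]; first by alia.
    by have := fail_size T fs N x0; alia.
- move=> s2 k2 _ [x [Nx xw Ex Hb Hk2]].
  rewrite !evalE => ry0; rewrite ry0 eqxx in Hb Hk2.
  split; first alia.
  apply: wp_nil; split; last alia.
  by rewrite Hb; split=> [[t Ht _]|[t Ht]]; exists t.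
Qed.

(** * Inner image factors, and the composition of the phases *)

Lemma prefix_rconsE (s v : seq A) a :
  prefix v (rcons s a) = (v == rcons s a) || prefix v s.
Proof.
by rewrite -suffix_rev rev_rcons suffix_consE suffix_rev -rev_rcons (can_eq revK).
Qed.

Lemma inner_ok s k k1 : tables s -> (forall p, p <= N -> fail_inv s p) ->
  12 * N + 10 + k1 <= k ->
  wp W inner_loop (fun s' k' => ((reg s' rBad != 0) <-> reg s rBad != 0 \/
     exists v, [/\ v \in imgs, infix w v, ~~ prefix w v & ~~ suffix w v]) /\
     k1 <= k') s k.
Proof.
move=> HT HF Hk; have [[EM EN EK EF] _ _ HN HI] := HT.
have [|K EKK] := @credits 1 k; first by alia.
rewrite {}EKK in Hk *.
have w0 : w != [::] by rewrite -size_eq0 size_w; alia.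
apply: (wp_let (v := 0)); first by rewrite !evalE.
apply: (wp_while (I := fun s2 k2 => [/\ reg s2 rk <= m,
  (* At a flagged position the registers still concern the preceding word; they are reset before
     use. *)
  ~~ fs (reg s2 rk) -> reg s2 ry = infix w (pref (reg s2 rk)) /\
                       reg s2 rh = prefix w (pref (reg s2 rk)),
  (reg s2 rBad != 0) <-> reg s rBad != 0 \/
    exists p, [/\ 0 < p <= reg s2 rk, fs p, infix w (pref p), ~~ prefix w (pref p) &
                ~~ suffix w (pref p)] &
  7 * (m - reg s2 rk) + 1 + k1 <= k2])).
- split=> //=; rewrite /upd /= ?fs0 //; last by alia.
  by split=> [|[//|[p []]]]; [left|rewrite leqn0; alia].
- move=> s2 k2 [Fr Fa] [km Hi Hb Hk2].
  rewrite !evalE (Fr rM isT) /= /upd /= EM eqb0 negbK => ltk.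
  have [|K2 EK2] := @credits 7 k2; first by alia.
  rewrite {}EK2 in Hk2 *; split=> //.
  set j := reg s2 rk in ltk Hi Hb Hk2 km *.
  have jN : j < N by apply: leq_trans ltk (ltnW mN).
  have EFj p : p <= N -> arr s2 aFs p = fs p by move=> pN; rewrite (Fa aFs isT) /= EF.
  have [_ _ Hhw] := HF j.+1 jN.
  apply: (wp_let (v := infix w (par j))).
    apply: eval_ite; last by case: (infix _ _); ania.
    rewrite !evalE -/j EFj; last exact: ltnW.
    rewrite eqb0 negbK /par; case: ifPn => Hf; first by rewrite infixs0 (negbTE w0).
    by case: (Hi Hf).
  apply: (wp_let (v := prefix w (par j))).
    apply: eval_ite; last by case: (prefix _ _); ania.
    rewrite !evalE /= /upd /= -/j EFj; last exact: ltnW.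
    rewrite eqb0 negbK /par; case: ifPn => Hf; first by rewrite prefixs0 (negbTE w0).
    by case: (Hi Hf).
  apply: (wp_let (v := j.+1)).
    by rewrite !evalE /= /upd /= -/j small ?addn1 //; ania.
  apply: (wp_let (v := infix w (pref j.+1))).
    rewrite !evalE /= /upd /= (Fa aHw isT) /= Hhw eqb0 negbK prefS infix_rconsl -prefS.
    by rewrite orbC.
  apply: (wp_let (v := prefix w (pref j.+1))).
    rewrite !evalE /= /upd /= (Fa aNd isT) (Fr rN isT) /= /upd /= EN.
    rewrite (HN _ (leqnn N)).1 (HN _ jN).1 !eqb0 !negbK prefS prefix_rconsE -prefS orbC.
    congr (nat_of_bool (_ || _)); rewrite eq_sym; apply/eqP/eqP => [/ids_inj|->//].
    by apply; apply: node_pref.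
  apply: (wp_let (v := (reg s2 rBad != 0) || [&& fs j.+1, infix w (pref j.+1),
      ~~ prefix w (pref j.+1) & ~~ suffix w (pref j.+1)])).
    by rewrite !evalE /= /upd /= EFj // (Fa aHw isT) /= -Hhw !eqb0 !negbK.
  apply: wp_nil; split=> //; rewrite /= /upd /=; last by alia.
  rewrite eqb0 negbK; split.
    case/orP=> [/Hb[|[p [pj f H1 H2 H3]]]|/and4P[f H1 H2 H3]]; first by left.
      by right; exists p; split=> //; alia.
    by right; exists j.+1; split=> //; alia.
  case=> [H|[p [pj f H1 H2 H3]]]; first by apply/orP; left; apply/Hb; left.
  case: (eqVneq p j.+1) => [E|ne]; first by rewrite -E f H1 H2 H3 orbT.
  by apply/orP; left; apply/Hb; right; exists p; split=> //; alia.
- move=> s2 k2 [Fr Fa] [km Hi Hb Hk2].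
  rewrite !evalE (Fr rM isT) /= /upd /= EM => /eqP; rewrite eqb0 -leqNgt => mk.
  have Ek : reg s2 rk = m by apply/eqP; rewrite eqn_leq km.
  split; first alia.
  apply: wp_nil; rewrite Ek in Hb; split; last alia.
  rewrite Hb; split=> -[|[p]]; [by left| |by left|].
    by move=> [pm f H1 H2 H3]; right; exists (pref p); split=> //;
      apply/imgsP; exists p; split=> //; alia.
  by move=> [/imgsP[q [q0 qm f <-]] H1 H2 H3]; right; exists q; split=> //; alia.
Qed.

Definition clean s := forall a p, a \in [:: aF; aDl; aHw; aMk] -> arr s a p = 0.

(** The initial zeros are right for the root: its links lead to node 0, and [w] is non-empty. *)
Lemma fail_inv0 s : clean s -> fail_inv s 0.
Proof.
move=> Hc; rewrite /fail_inv !Hc // fail_nil; split; first by rewrite ids_nil.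
  by rewrite (_ : dl (pref 0) = [::]) ?ids_nil //; apply: lsuf_nil.
by rewrite eqxx suffixs0 -size_eq0 size_w; lia.
Qed.

Lemma main_ok s k : env s -> reg s rk = 0 -> trie_inv 0 s -> class_inv 0 s ->
  clean s -> reg s rBad = 0 ->
  (exists2 q, size q = reg s rt &
     (forall i, i < size q -> arr s aQ i = nth 0 q i) /\ queue_inv T fs N q 0) ->
  120 * N + 50 + 4 * (\sum_(m.+1 <= p < N.+1) cnt imgs (pref p)) <= k ->
  wp W (insert_loop ++ Assign rh (Const 0) :: fail_loop ++ mark_loop ++ reach_loop ++
        end_loop ++ inner_loop ++ [:: Assign 0 (NotE (Reg rBad))])
    (fun s' _ => (reg s' 0 != 0) <-> ~ interf imgs w /\
       ~ exists v, [/\ v \in imgs, infix w v, ~~ prefix w v & ~~ suffix w v]) s k.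
Proof.
set Sg := \sum_(_ <= _ < _) _.
move=> He Ek HT0 HC0 Hcl Eb [q Eq [Hq Hqi]] Hk.
have [|K EK] := @credits (120 * N + 50 + 4 * Sg) k; first exact: Hk.
rewrite {}EK {Hk}.
(* [k1] is what a phase leaves to the following ones; 120 = 20 + 60 + 12 + 12 + 4 + 12. *)
apply: wp_seq; first apply: (insert_ok (k1 := 100 * N + 49 + 4 * Sg)) => //; first by lia.
move=> s1 k1 F1 [HT1 HC1 Hk1].
have He1 : env s1.
  case: He => E1 E2 E3 E4; case: F1 => Fr Fa.
  by split; [rewrite Fr|rewrite Fr|rewrite Fr|move=> p; rewrite Fa // => /E4].
have T1 := tables_intro He1 HT1 HC1.
have cl1 : clean s1.
  move=> a p Ha; rewrite (frame_arr F1) ?Hcl //; move: Ha.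
  by rewrite !inE => /or4P[]/eqP->.
have Eb1 : reg s1 rBad = 0 by rewrite (frame_reg F1).
have Eq1 : size q = reg s1 rt by rewrite (frame_reg F1).
have Hq1 i : i < size q -> arr s1 aQ i = nth 0 q i by move=> iq; rewrite (frame_arr F1) ?Hq.
have [|K1 EK1] := @credits 1 k1; first by alia.
rewrite {}EK1 in Hk1 *.
apply: (wp_let (v := 0)); first by rewrite !evalE.
apply: wp_seq.
  apply: (fail_ok (k1 := 40 * N + 41 + 4 * Sg)); last by alia.
  - exact: T1.
  - by [].
  - by exists q.
  - exact: (fail_inv0 cl1).
move=> {K1 Hk1}s2 k2 F2 [HF2 Hk2].
have T2 : tables s2.
  have T1' : tables (set_reg s1 rh 0) := T1.
  exact: tables_frame T1' F2 isT isT.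
have Eb2 : reg s2 rBad = 0 by rewrite (frame_reg F2).
apply: wp_seq.
  apply: (mark_ok (k1 := 28 * N + 31 + 4 * Sg)) => //; last by alia.
  by move=> p _; rewrite (frame_arr F2) //= cl1.
move=> s3 k3 F3 [HM3 Hk3].
have T3 := tables_frame T2 F3 isT isT.
have HF3 p : p <= N -> fail_inv s3 p.
  by move=> /HF2 [? ? ?]; split; rewrite (frame_arr F3).
have Eb3 : reg s3 rBad = 0 by rewrite (frame_reg F3).
apply: wp_seq; first by apply: (reach_ok (k1 := 16 * N + 21)) => //; rewrite -/Sg; alia.
move=> s4 k4 F4 [HR4 Hk4].
have T4 := tables_frame T3 F4 isT isT.
have HF4 p : p <= N -> fail_inv s4 p.
  by move=> /HF3 [? ? ?]; split; rewrite (frame_arr F4).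
have Eb4 : reg s4 rBad = 0 by rewrite (frame_reg F4).
apply: wp_seq; first by apply: (end_ok (k1 := 12 * N + 10 + 1)) => //; alia.
move=> s5 k5 F5 [HE5 Hk5].
have T5 := tables_frame T4 F5 isT isT.
have HF5 p : p <= N -> fail_inv s5 p.
  by move=> /HF4 [? ? ?]; split; rewrite (frame_arr F5).
apply: wp_seq; first by apply: (inner_ok (k1 := 1)) => //; alia.
move=> s6 k6 F6 [HI6 Hk6].
have [|K6 EK6] := @credits 1 k6; first by alia.
rewrite {}EK6; apply: wp_let => //; apply: wp_nil.
have imgs0 : imgs != [::].
  have /imgsP : exists p, [/\ 0 < p, p <= m, fs p & pref p = pref m] by exists m.
  by case: (imgs).
rewrite /= /upd /= !evalE eqb0 negbK; have HX := interfP w imgs_nil imgs0.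
rewrite HX -HE5; split=> [E6|[H1 H2]].
  by split=> H; move: E6; apply/negP; apply/HI6; [left|right].
by apply: contraT => /HI6[].
Qed.

End Phases.

(** * Layout of the input *)

Section Layout.
Variables (A : eqType) (a0 : A) (vs : seq (seq A)).
Hypothesis vs_nil : [::] \notin vs.

Definition st c := size (flatten (take c vs)).
Definition letter k := nth a0 (flatten vs) k.
(** The end of the text counts as a start, so that every word ends at a flagged position. *)
Definition starts p := has (fun c => st c == p) (iota 0 (size vs).+1).

Local Notation word c := (nth [::] vs c).
Local Notation N := (size (flatten vs)).

Lemma st0 : st 0 = 0.
Proof. by rewrite /st take0. Qed.

Lemma stS c : c < size vs -> st c.+1 = st c + size (word c).
Proof. by move=> H; rewrite /st (take_nth [::]) // flatten_rcons size_cat. Qed.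

Lemma st_size : st (size vs) = N.
Proof. by rewrite /st take_size. Qed.

Lemma word_gt0 c : c < size vs -> 0 < size (word c).
Proof.
by move=> H; rewrite lt0n size_eq0; apply: contraNneq vs_nil => <-; apply: mem_nth.
Qed.

Lemma st_lt c d : c < d <= size vs -> st c < st d.
Proof.
move=> /andP[cd]; elim: d cd => // d IH; rewrite ltnS leq_eqVlt => H dv.
have := word_gt0 dv; rewrite stS //; case/predU1P: H => [->|cd]; first by lia.
by have := IH cd (ltnW dv); lia.
Qed.

Lemma st_le c d : c <= d <= size vs -> st c <= st d.
Proof.
move=> /andP[]; rewrite leq_eqVlt => /predU1P[->|cd dv]; first by rewrite leqnn.
by apply: ltnW; apply: st_lt; rewrite cd.
Qed.

Lemma startsP p : reflect (exists2 c, c <= size vs & st c = p) (starts p).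
Proof.
apply: (iffP hasP) => [[c]|[c cv E]].
  by rewrite mem_iota => cv /eqP E; exists c.
by exists c; rewrite ?mem_iota ?E.
Qed.

Lemma split_pos k : k < N ->
  exists c j, [/\ c < size vs, j < size (word c) & k = st c + j].
Proof.
rewrite -st_size; have := leqnn (size vs); move: {1 3}(size vs) => d.
elim: d => [|d IH]; first by rewrite st0.
move=> dv; rewrite stS // => kd; case: (ltnP k (st d)) => H.
  by apply: IH => //; apply: ltnW.
by exists d, (k - st d); split=> //; lia.
Qed.

Lemma starts_pos c j : c < size vs -> j < size (word c) -> starts (st c + j) = (j == 0).
Proof.
move=> cv jc; apply/startsP/eqP => [[d dv E]|->]; last by exists c; rewrite ?addn0 // ltnW.
case: (leqP d c) => dc.
  have : st d <= st c by apply: st_le; rewrite dc ltnW.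
  by lia.
have : st c.+1 <= st d by apply: st_le; rewrite dc.
by rewrite stS //; lia.
Qed.

Lemma letter_pos c j : c < size vs -> j < size (word c) ->
  letter (st c + j) = nth a0 (word c) j.
Proof.
move=> cv jc; rewrite /letter -{1}(cat_take_drop c vs) flatten_cat nth_cat.
by rewrite ltnNge leq_addr /= -/(st c) addKn (drop_nth [::]) //= nth_cat jc.
Qed.

(** [j = 0] is excluded since at [st c], for [c > 0], [pref] spells the preceding word; [par] covers
    that case. *)
Lemma pref_pos c j : c < size vs -> j <= size (word c) -> 0 < j ->
  pref letter starts (st c + j) = take j (word c).
Proof.
move=> cv; elim: j => // j IH jc _; rewrite addnS prefS /par starts_pos //.
rewrite (take_nth a0) // letter_pos //; case: j IH jc => [|j] IH jc.
  by rewrite take0.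
by rewrite IH // ltnW.
Qed.

Lemma par_pos c j : c < size vs -> j < size (word c) ->
  par letter starts (st c + j) = take j (word c).
Proof.
move=> cv jc; rewrite /par starts_pos //; case: j jc => [|j] jc; first by rewrite take0.
by rewrite /= pref_pos // ltnW.
Qed.

Lemma queue_init : queue_inv letter starts N [seq st c | c <- iota 0 (size vs)] 0.
Proof.
have st_inj c d : c <= size vs -> d <= size vs -> st c = st d -> c = d.
  move=> cv dv E; case: (ltngtP c d) => // cd.
    by have := st_lt (c := c) (d := d); rewrite cd dv E ltnn => /(_ isT).
  by have := st_lt (c := d) (d := c); rewrite cd cv E ltnn => /(_ isT).
have memq k : k \in [seq st c | c <- iota 0 (size vs)] -> starts k /\ k < N.
  move=> /mapP[c]; rewrite mem_iota => /andP[_ cv] ->; split.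
    by apply/startsP; exists c => //; apply: ltnW.
  by rewrite -st_size st_lt // cv leqnn.
split.
- rewrite map_inj_in_uniq ?iota_uniq // => c d; rewrite !mem_iota => cv dv.
  by apply: st_inj; lia.
- by move=> k /memq[].
- move=> k kN /startsP[c cv E]; apply/mapP; exists c => //; rewrite mem_iota.
  by move: cv; rewrite leq_eqVlt => /predU1P[cv|//]; rewrite -E cv st_size ltnn in kN.
- move=> k kN Hk; rewrite take0 in_nil; apply: contraNF Hk.
  by move=> /memq[].
- move=> i j /andP[ij jq]; have iq := ltn_trans ij jq.
  set q := map _ _ in ij jq iq *.
  have [Hi _] := memq _ (mem_nth 0 iq); have [Hj _] := memq _ (mem_nth 0 jq).
  by rewrite !prefS /par Hi Hj.
Qed.

End Layout.

(** * The text made of the images followed by [w] *)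

Section WordLayout.
Variables (A : eqType) (a0 : A) (ws : seq (seq A)) (w : seq A).
Hypotheses (ws_nil : [::] \notin ws) (w_nil : w != [::]).

Local Notation vs := (rcons ws w).
Local Notation N := (size (flatten vs)).
Local Notation m := (size (flatten ws)).
Local Notation starts := (starts vs).
Local Notation letter := (letter a0 vs).
Local Notation st := (st vs).

Lemma vs_nil' : [::] \notin vs.
Proof. by rewrite mem_rcons inE negb_or eq_sym w_nil. Qed.

Lemma st_m : st (size ws) = m.
Proof.
by rewrite -[LHS]/(size (flatten (take (size ws) vs))) -cats1 take_size_cat.
Qed.

Lemma word_ws c : c < size ws -> nth [::] vs c = nth [::] ws c.
Proof. by move=> H; rewrite nth_rcons H. Qed.

Lemma layout_N : N = m + size w.
Proof. by rewrite flatten_rcons size_cat. Qed.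

Lemma size_vs : size vs = (size ws).+1.
Proof. by rewrite size_rcons. Qed.

Lemma layout_w : pref letter starts N = w.
Proof.
have Ew : nth [::] vs (size ws) = w by rewrite nth_rcons ltnn eqxx.
rewrite layout_N -{1}st_m pref_pos ?Ew ?take_size ?lt0n ?size_eq0 //; first exact: vs_nil'.
by rewrite size_vs.
Qed.

Lemma pos_ws k : k < m -> exists c j,
  [/\ c < size ws, j < size (nth [::] ws c) & k = st c + j].
Proof.
move=> km; have [|c [j [cv jc E]]] := @split_pos A vs vs_nil' k.
  by rewrite layout_N; apply: leq_trans km (leq_addr _ _).
have cw : c < size ws.
  move: cv; rewrite size_vs ltnS leq_eqVlt => /predU1P[cE|//].
  by move: km; rewrite E cE st_m ltnNge leq_addr.
by exists c, j; rewrite -word_ws.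
Qed.

Lemma layout_starts_w k : m < k < N -> ~~ starts k.
Proof.
move=> /andP[mk kN]; apply/startsP => -[c cv E]; rewrite size_vs in cv.
have N_st : st (size ws).+1 = N by rewrite -size_vs st_size.
case: (leqP c (size ws)) => cw.
  have : st c <= st (size ws) by apply: st_le; [exact: vs_nil'|rewrite cw size_vs leqnSn].
  by rewrite st_m E leqNgt mk.
have Ec : c = (size ws).+1 by lia.
by rewrite -E Ec N_st ltnn in kN.
Qed.

Lemma layout_images v :
  v \in ws <-> exists p, [/\ 0 < p, p <= m, starts p & pref letter starts p = v].
Proof.
have Hv := vs_nil'; split.
- move=> /(nthP [::])[c cw <-]; exists (st c.+1).
  have cv : c < size vs by rewrite size_vs ltnS ltnW.
  have c0 : 0 < size (nth [::] vs c) by apply: word_gt0.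
  rewrite -word_ws // stS //; split.
  + by lia.
  + by rewrite -st_m -stS //; apply: st_le => //; rewrite cw size_vs leqnSn.
  + by rewrite -stS //; apply/startsP; exists c.+1.
  + by rewrite pref_pos ?take_size.
- move=> [[|k] [k0 km Hs <-]] //; have [c [j [cw jc E]]] := pos_ws km.
  have cv : c < size vs by rewrite size_vs ltnS ltnW.
  have jc' : j < size (nth [::] vs c) by rewrite word_ws.
  move: Hs; rewrite E -addnS pref_pos // word_ws //.
  move: jc; rewrite leq_eqVlt => /predU1P[-> _|jc].
    by rewrite take_size; apply: mem_nth.
  by rewrite starts_pos ?word_ws.
Qed.

Lemma layout_pp v :
  is_pp ws v <-> exists i, i < m /\ par letter starts i = v.
Proof.
have Hv := vs_nil'; split.
- move=> /hasP[x /(nthP [::])[c cw <-] /andP[Hp ne]].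
  have cv : c < size vs by rewrite size_vs ltnS ltnW.
  have vc : size v < size (nth [::] ws c).
    rewrite ltn_neqAle size_prefix // andbT; apply: contraNneq ne => E.
    by move: Hp; rewrite prefixE E take_size eq_sym.
  exists (st c + size v); split.
    rewrite -st_m; apply: (@leq_trans (st c.+1)); first by rewrite stS // word_ws // ltn_add2l.
    by apply: st_le => //; rewrite cw size_vs leqnSn.
  by rewrite par_pos ?word_ws //; apply/eqP; rewrite -prefixE.
- move=> [i [im <-]]; have [c [j [cw jc ->]]] := pos_ws im.
  have cv : c < size vs by rewrite size_vs ltnS ltnW.
  rewrite par_pos ?word_ws //; apply/hasP; exists (nth [::] ws c); first exact: mem_nth.
  rewrite /ppre prefix_take; apply/eqP => /(congr1 size).
  by rewrite size_takel ?(ltnW jc) // => E; rewrite E ltnn in jc.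
Qed.

End WordLayout.

(** The starts stored in [aQ] serve twice: to find the image of a letter of [u] when copying, and as
    the initial queue. *)
Definition setup : program :=
  [:: While (Lt (Reg rk) (Reg 0))
        [:: Put aQ (Reg rk) (Reg rM);
            Put aFs (Reg rM) (Const 1);
            Assign rM (Add (Reg rM) (Get aLen (Reg rk)));
            Incr rk];
      Put aQ (Reg rk) (Reg rM);
      Put aFs (Reg rM) (Const 1);
      Assign rt (Add (Reg rk) (Const 1));
      Assign rN (Reg rM);
      Assign rk (Const 0);
      While (Lt (Reg rk) (Reg 1))
        [:: Assign rx (Get aQ (Get aU (Reg rk)));
            Assign ry (Add (Reg rx) (Get aLen (Get aU (Reg rk))));
            While (Lt (Reg rx) (Reg ry))
              [:: Put aT (Reg rN) (Get aT (Reg rx)); Incr rx; Incr rN];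
            Incr rk];
      Put aFs (Reg rN) (Const 1);
      Assign rK (Add (Reg rN) (Const 1));
      Assign rk (Const 0)].

(** * Building the text from the input, and the whole algorithm *)

Section Setup.
Variables (A : eqType) (a0 : A) (rank : A -> nat) (W : nat).
Variables (ws : seq (seq A)) (us : seq nat).
Hypotheses (ws_nil : [::] \notin ws) (us_ws : forall c, c \in us -> c < size ws).
Hypothesis us_nil : us != [::].

Let factors := [seq nth [::] ws c | c <- us].
Let w := flatten factors.
Local Notation vs := (rcons ws w).
Local Notation N := (size (flatten vs)).
Local Notation m := (size (flatten ws)).
Hypothesis HW : N.+2 * N.+2 <= 2 ^ W.

Local Notation small := (small_mod HW).
Local Notation evalE := (eval_rules HW).

Lemma factors_nil : [::] \notin factors.
Proof.
apply/mapP => -[c /us_ws cw E]; move: ws_nil; rewrite E.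
by rewrite mem_nth.
Qed.

Lemma w_nil : w != [::].
Proof.
have u0 : 0 < size factors by rewrite size_map lt0n size_eq0.
have := word_gt0 factors_nil u0; rewrite /w -size_eq0 -lt0n -st_size => H.
by apply: leq_ltn_trans (leq0n (st factors 0)) _; apply: (st_lt factors_nil); rewrite u0 leqnn.
Qed.

(** Makes the loops over the alphabet and over [u] linear in [m] and [n]. *)
Lemma size_flatten_ge (ts : seq (seq A)) : [::] \notin ts -> size ts <= size (flatten ts).
Proof.
elim: ts => // t ts IH; rewrite inE negb_or => /andP[t0 /IH H] /=.
by rewrite size_cat; case: t t0 => //= a t _; lia.
Qed.

Definition ready s :=
  [/\ [/\ reg s rM = m, reg s rN = N, reg s rK = N.+1, reg s rk = 0 &
        reg s rt = size vs],
      forall p, arr s aFs p = starts vs p,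
      forall k, k < N -> arr s aT k = rank (letter a0 vs k) &
      forall c, c < size vs -> arr s aQ c = st vs c].

Lemma setup_ok s k k1 :
  [/\ reg s 0 = size ws, reg s 1 = size us, reg s rM = 0 & reg s rk = 0] ->
  (forall p, p < m -> arr s aT p = rank (nth a0 (flatten ws) p)) ->
  (forall c, c < size ws -> arr s aLen c = size (nth [::] ws c)) ->
  (forall i, i < size us -> arr s aU i = nth 0 us i) ->
  (forall p, arr s aFs p = 0) -> 20 * N + 20 + k1 <= k ->
  wp W setup (fun s' k' => ready s' /\ k1 <= k') s k.
Proof.
move=> [E0 E1 EM Ek] HT HL HU HF Hk.
have Hv := vs_nil' ws_nil w_nil; have Ew := layout_N ws w.
have Sm : size ws <= m by apply: size_flatten_ge.
have Uw : size us <= size w.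
  by rewrite -(size_map (nth [::] ws) us); apply: size_flatten_ge; apply: factors_nil.
have stW c : c < size ws -> st vs c.+1 = st vs c + size (nth [::] ws c).
  by move=> cw; rewrite stS ?word_ws // size_rcons ltnS ltnW.
have stm : st vs (size ws) = m := st_m ws w.
have st_lem c : c <= size ws -> st vs c <= m.
  by move=> cw; rewrite -stm; apply: st_le => //; rewrite cw size_rcons leqnSn.
have m_lt : m < N by rewrite Ew -{1}(addn0 m) ltn_add2l lt0n size_eq0 w_nil.
pose fsk c s := forall p, arr s aFs p = has (fun d => st vs d == p) (iota 0 c).
have fskS c s1 s2 : fsk c s1 ->
    (forall p, arr s2 aFs p = if p == st vs c then 1 else arr s1 aFs p) -> fsk c.+1 s2.
  move=> H1 H2 p; rewrite H2 H1 -[c.+1]addn1 iotaD has_cat /= orbF add0n eq_sym.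
  by case: eqP => [_|]; rewrite ?orbT ?orbF.
apply: (wp_while (I := fun s k => [/\ reg s rk <= size ws, reg s rM = st vs (reg s rk),
  forall c, c < reg s rk -> arr s aQ c = st vs c, fsk (reg s rk) s &
  5 * (size ws - reg s rk) + 15 * N + 15 + k1 <= k])).
- rewrite Ek; split=> //; first by rewrite EM st0.
  by alia.
- move=> s1 k' [Fr Fa] [cw EM1 HQ HFs Hk'].
  rewrite !evalE (Fr 0 isT) E0 eqb0 negbK => ltc.
  have [|K EK] := @credits 5 k'; first by alia.
  rewrite {}EK in Hk' *; split=> //.
  set c := reg s1 rk in cw EM1 HQ HFs Hk' ltc *.
  have := st_lem _ ltc => stc.
  apply: (wp_set (j := c) (v := st vs c)); [by []|by rewrite !evalE EM1|].
  apply: (wp_set (j := st vs c) (v := 1)); [by rewrite !evalE /= EM1|by rewrite !evalE|].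
  apply: (wp_let (v := st vs c.+1)).
    rewrite !evalE /= /upd /= -/c EM1 (Fa aLen isT) HL // -stW // small //.
    by ania.
  apply: (wp_let (v := c.+1)).
    by rewrite !evalE /= /upd /= -/c small ?addn1 //; ania.
  apply: wp_nil; rewrite /= /upd /=; split=> //.
  + move=> d; rewrite ltnS leq_eqVlt => /predU1P[->|dc]; first by rewrite eqxx.
    by rewrite ltn_eqF // HQ.
  + by apply: fskS HFs _ => p; rewrite /= /upd /=.
  + by alia.
- move=> s1 k' [Fr Fa] [cw EM1 HQ HFs Hk'].
  rewrite !evalE (Fr 0 isT) E0 => /eqP; rewrite eqb0 -leqNgt => cw'.
  have Ec : reg s1 rk = size ws by apply/eqP; rewrite eqn_leq cw.
  rewrite Ec stm in EM1 HQ HFs Hk'.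
  have [|K EK] := @credits 6 k'; first by alia.
  rewrite {}EK in Hk' *; split=> //.
  apply: (wp_set (j := size ws) (v := m)); [by rewrite !evalE Ec|by rewrite !evalE|].
  apply: (wp_set (j := m) (v := 1)); [by rewrite !evalE /= EM1|by rewrite !evalE|].
  apply: (wp_let (v := size vs)).
    rewrite !evalE /= /upd /= Ec small ?size_rcons ?addn1 //; ania.
  apply: (wp_let (v := m)); first by rewrite !evalE.
  apply: (wp_let (v := 0)); first by rewrite !evalE.
  set s2 := set_reg _ rk 0.
  have HFs2 : fsk (size ws).+1 s2.
    by apply: fskS HFs _ => p; rewrite stm.
  have HQ2 c : c < size vs -> arr s2 aQ c = st vs c.
    rewrite size_rcons ltnS leq_eqVlt /= /upd /= => /predU1P[->|cv].
      by rewrite eqxx stm.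
    by rewrite ltn_eqF // HQ.
  have HT2 p : p < m -> arr s2 aT p = rank (letter a0 vs p).
    move=> pm; rewrite /letter flatten_rcons nth_cat pm -HT //=.
    by rewrite /upd /= (Fa aT isT).
  have ER2 : [/\ reg s2 rM = m, reg s2 rN = m, reg s2 rt = size vs & reg s2 rk = 0].
    by rewrite /= /upd /= EM1.
  have EI2 : [/\ reg s2 1 = size us, arr s2 aLen = arr s aLen & arr s2 aU = arr s aU].
    by rewrite /= /upd /= (Fr 1 isT) (Fa aLen isT) (Fa aU isT).
  have Hk2 : 15 * N + 9 + k1 <= K by alia.
  move: s2 HFs2 HQ2 HT2 ER2 EI2 => s2 HFs2 HQ2 HT2 [ER2 ER3 ER4 ER5] [EI1 EI2 EI3].
  clear Fr Fa EM1 HQ HFs Hk' Hk cw cw' Ec HT E0 E1 EM Ek HF k.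
  apply: (wp_while (I := fun s k => [/\ reg s rk <= size us,
    reg s rN = m + st factors (reg s rk),
    forall p, p < reg s rN -> arr s aT p = rank (letter a0 vs p) &
    6 * (size us - reg s rk) + 4 * (N - reg s rN) + 5 + k1 <= k])).
  + by rewrite ER3 ER5 st0 addn0; split=> //; alia.
  + move=> s3 k3 Ff [iu EN3 HT3 Hk3]; have [Fr Fa] := Ff.
    rewrite !evalE (Fr 1 isT) EI1 eqb0 negbK => lti.
    have [|K3 EK] := @credits 5 k3; first by alia.
    rewrite {}EK in Hk3 *; split=> //.
    set i := reg s3 rk in iu EN3 HT3 Hk3 lti *.
    pose c := nth 0 us i.
    have cw : c < size ws by apply: us_ws; apply: mem_nth.
    have cv : c < size vs by rewrite size_rcons ltnS ltnW.
    have EU : arr s3 aU i = c by rewrite (Fa aU isT) EI3 HU.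
    have ifac : i < size factors by rewrite size_map.
    have Efac : nth [::] factors i = nth [::] ws c by rewrite (nth_map 0).
    have Sfac : st factors i.+1 = st factors i + size (nth [::] ws c).
      by rewrite stS // Efac.
    have Hfac : m + st factors i.+1 <= N.
      by rewrite Ew leq_add2l -st_size; apply: (st_le factors_nil); rewrite leqnn andbT.
    have stc : st vs c + size (nth [::] ws c) <= m by rewrite -stW // st_lem.
    apply: (wp_let (v := st vs c)).
      by rewrite !evalE -/i EU (Fa aQ isT) HQ2.
    apply: (wp_let (v := st vs c + size (nth [::] ws c))).
      rewrite !evalE /= /upd /= -/i EU (Fa aLen isT) EI2 HL // small //; ania.
    apply: (wp_while (I := fun s k => exists d, [/\ d <= size (nth [::] ws c),
      reg s rx = st vs c + d, reg s rN = m + st factors i + d,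
      forall p, p < reg s rN -> arr s aT p = rank (letter a0 vs p) &
      6 * (size us - i.+1) + 4 * (N - reg s rN) + 7 + k1 <= k])).
    * exists 0; split=> //=; rewrite /upd /= ?addn0 //.
      by move: Hk3; alia.
    * move=> s4 k4 [Fr4 Fa4] [d [dc Ex EN4 HT4 Hk4]].
      rewrite !evalE Ex (Fr4 ry isT) /= /upd /= eqb0 negbK ltn_add2l => ltd.
      have [|K4 EK] := @credits 4 k4; first by alia.
      rewrite {}EK in Hk4 *; split=> //.
      rewrite Sfac in Hfac.
      (* Factor [i] of [w] is the word [c]. *)
      have EL : letter a0 vs (st vs c + d) = letter a0 vs (m + st factors i + d).
        rewrite letter_pos ?word_ws // /letter flatten_rcons nth_cat -addnA.
        rewrite ltnNge leq_addr /= addKn -/(letter a0 factors _) letter_pos ?Efac //.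
      apply: (wp_set (j := m + st factors i + d)
               (v := rank (letter a0 vs (m + st factors i + d)))).
      - by rewrite !evalE.
      - by rewrite !evalE Ex HT4 ?EL // EN4; alia.
      apply: (wp_let (v := st vs c + d.+1)).
        by rewrite !evalE /= /upd /= Ex small ?addn1 ?addnS //; ania.
      apply: (wp_let (v := m + st factors i + d.+1)).
        by rewrite !evalE /= /upd /= EN4 small ?addn1 ?addnS //; ania.
      apply: wp_nil; exists d.+1; split=> //=; rewrite /upd /=.
      - move=> p; rewrite addnS ltnS leq_eqVlt => /predU1P[->|pd]; first by rewrite eqxx.
        by rewrite ltn_eqF // HT4 // EN4.
      - by rewrite EN4 in Hk4; alia.
    * move=> s4 k4 [Fr4 Fa4] [d [dc Ex EN4 HT4 Hk4]].
      rewrite !evalE Ex (Fr4 ry isT) /= /upd /= => /eqP.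
      rewrite eqb0 ltn_add2l -leqNgt => cd.
      have Ed : d = size (nth [::] ws c) by apply/eqP; rewrite eqn_leq dc.
      have Ei4 : reg s4 rk = i by rewrite (Fr4 rk isT).
      have [|K4 EK] := @credits 2 k4; first by alia.
      rewrite {}EK in Hk4 *; split=> //.
      have EN4' : reg s4 rN = m + st factors i.+1 by rewrite EN4 Ed Sfac addnA.
      apply: (wp_let (v := i.+1)).
        by rewrite !evalE Ei4 small ?addn1 //; ania.
      by apply: wp_nil; rewrite /= /upd /=; split=> //; alia.
  + move=> s3 k3 [Fr Fa] [iu EN3 HT3 Hk3].
    rewrite !evalE (Fr 1 isT) EI1 => /eqP; rewrite eqb0 -leqNgt => iu'.
    have Ei : reg s3 rk = size us by apply/eqP; rewrite eqn_leq iu.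
    have ENf : reg s3 rN = N.
      by rewrite EN3 Ei Ew -(size_map (nth [::] ws) us) (st_size factors).
    have [|K3 EK] := @credits 4 k3; first by alia.
    rewrite {}EK in Hk3 *; split=> //.
    apply: (wp_set (j := N) (v := 1)); [by rewrite !evalE|by rewrite !evalE|].
    apply: (wp_let (v := N.+1)).
      by rewrite !evalE /= /upd /= ENf small ?addn1 //; ania.
    apply: (wp_let (v := 0)); first by rewrite !evalE.
    apply: wp_nil; split; last by alia.
    have Nst : st vs (size ws).+1 = N by rewrite -st_size size_rcons.
    split; rewrite /= /upd /=.
    * by split=> //; rewrite ?(Fr rM isT) ?(Fr rt isT).
    * move=> p; rewrite (Fa aFs isT) /starts size_rcons.
      apply: (fskS _ s2 (set_arr s2 aFs N 1)) => //.
      by move=> q; rewrite /= /upd /= Nst.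
    * by move=> p pN; rewrite HT3 // ENf.
    * by move=> c cv; rewrite (Fa aQ isT) HQ2.
Qed.

Definition algorithm : program :=
  setup ++ insert_loop ++ Assign rh (Const 0) :: fail_loop ++ mark_loop ++ reach_loop ++
  end_loop ++ inner_loop ++ [:: Assign 0 (NotE (Reg rBad))].

Lemma algorithm_ok s k : injective rank -> uniq ws ->
  (forall x, reg s x = nth 0 [:: size ws; size us] x) ->
  (forall p, p < m -> arr s aT p = rank (nth a0 (flatten ws) p)) ->
  (forall c, c < size ws -> arr s aLen c = size (nth [::] ws c)) ->
  (forall i, i < size us -> arr s aU i = nth 0 us i) ->
  (forall a p, 2 < a -> arr s a p = 0) ->
  140 * N + 70 + 4 * (\sum_(1 <= j < (size w).+1) cnt ws (take j w)) <= k ->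
  wp W algorithm
    (fun s' _ => (reg s' 0 != 0) <-> ~ interf ws w /\
       ~ exists v, [/\ v \in ws, infix w v, ~~ prefix w v & ~~ suffix w v]) s k.
Proof.
set Sg := \sum_(_ <= _ < _) _.
move=> rank_inj ws_uniq HR HT HL HU HZ Hk.
have Hv := vs_nil' ws_nil w_nil; have Ew := layout_N ws w.
have m_lt : m < N by rewrite Ew -{1}(addn0 m) ltn_add2l lt0n size_eq0 w_nil.
apply: wp_seq.
  apply: (setup_ok (k1 := 120 * N + 50 + 4 * Sg)) => //; first by move=> p; rewrite HZ.
  by lia.
move=> s1 k1 F1 [[[E1 E2 E3 E4 E5] HF HT1 HQ] Hk1].
have HZ1 a p : 4 < a -> arr s1 a p = 0.
  move=> a4; rewrite (frame_arr F1); first by apply: HZ; lia.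
  by rewrite /prog_arrs /= !inE; case: a a4 => [|[|[|[|[|a]]]]].
have Hw := layout_w a0 ws_nil w_nil.
have m0 : 0 < m.
  have [c cu] : exists c, c \in us by case: (us) us_nil => // c l _; exists c; rewrite mem_head.
  by apply: leq_trans (size_flatten_ge ws_nil); apply: leq_ltn_trans (us_ws cu).
have st_m' : st vs (size ws) = m := st_m ws w.
have starts_st c : c <= size vs -> starts vs (st vs c) by move=> cv; apply/startsP; exists c.
(* Counted from 1, so that 0 can mean a letter not yet seen. *)
pose code a := (index a (flatten vs)).+1.
have mem_letter i : i < N -> letter a0 vs i \in flatten vs by apply: mem_nth.
have fs_w : forall k, m < k < N -> ~~ starts vs k.
  by move=> k2; apply: (layout_starts_w ws_nil w_nil).
have Esum : \sum_(m.+1 <= p < N.+1) cnt ws (pref (letter a0 vs) (starts vs) p) = Sg.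
  rewrite /Sg -(add1n m) -[N.+1](_ : (size w).+1 + m = _); last by rewrite Ew; lia.
  rewrite big_addn addnK; apply: eq_big_nat => j /andP[j0 jw].
  rewrite addnC -st_m' pref_pos ?nth_rcons ?ltnn ?eqxx ?size_rcons //.
have -> : (fun s' (_ : nat) => reg s' 0 != 0 <-> ~ interf ws w /\
    ~ exists v, [/\ v \in ws, infix w v, ~~ prefix w v & ~~ suffix w v]) =
  (fun s' _ => reg s' 0 != 0 <-> ~ interf ws (pref (letter a0 vs) (starts vs) N) /\
    ~ exists v, [/\ v \in ws, infix (pref (letter a0 vs) (starts vs) N) v,
      ~~ prefix (pref (letter a0 vs) (starts vs) N) v &
      ~~ suffix (pref (letter a0 vs) (starts vs) N) v]) by rewrite Hw.
apply: (main_ok (T := letter a0 vs) (fs := starts vs) (m := m) (N := N)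
  (code := code) (rank := rank)) => //.
- by rewrite -(st0 vs); apply: starts_st.
- by rewrite -st_m'; apply: starts_st; rewrite size_rcons.
- by rewrite -st_size; apply: starts_st.
- by move=> i iN; rewrite /code /= ltnS; apply: index_nth.
- move=> i j iN jN [<-]; rewrite /letter nth_index //; exact: mem_letter.
- exact: (layout_images a0 ws_nil w_nil).
- exact: (layout_pp a0 ws_nil w_nil).
- split.
  + by move=> i iN; rewrite HT1.
  + by move=> i iN; rewrite HZ1.
  + by move=> t i _ _; rewrite HZ1 //; case: leqP => // H; apply/eqP; rewrite eq_sym -leqn0.
  + by move=> p; rewrite leqn0 => /eqP->; rewrite !HZ1 ?ids_nil.
- split=> t _; rewrite HZ1 //; split=> // -[p []] //.
  by rewrite leqn0 andbC => /andP[/eqP->].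
- by move=> a p; rewrite !inE => /or4P[]/eqP->; rewrite HZ1.
- by rewrite (frame_reg F1) ?HR.
- exists [seq st vs c | c <- iota 0 (size vs)]; first by rewrite size_map size_iota.
  rewrite size_map size_iota; split; last exact: (queue_init a0 Hv).
  by move=> i iv; rewrite HQ // (nth_map 0) ?size_iota // nth_iota.
- by rewrite Esum.
Qed.
End Setup.

(** * From the logic to the machine *)

Section Machine.
Variable W : nat.

Lemma run_halted s tape : run W ([::], s) tape = ([::], s).
Proof. by elim: tape. Qed.

Lemma run_time_halted k t tape : halted k -> run_time W k tape <= t.
Proof. by case: tape => //= r tape ->. Qed.

Lemma run_time_le t k tape : halted (run W k (take t tape)) -> run_time W k tape <= t.
Proof.
elim: t k tape => [|t IH] k tape; first by rewrite take0 => /run_time_halted; apply.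
by case: tape => //= r tape H; case: ifP => // _; rewrite ltnS; apply: IH.
Qed.

Lemma run_time_size k tape : run_time W k tape <= size tape.
Proof. by elim: tape k => //= r tape IH k; case: ifP => // _; rewrite ltnS. Qed.

Lemma expected_time_leP k b :
  (forall tape, run_time W k tape <= b) -> expected_time_le W k b.
Proof.
move=> H t; rewrite /mean_time; set d := ((2 ^ W) ^ t).
have d0 : 0 < d by rewrite !expn_gt0.
rewrite Num.Theory.ler_pdivrMr ?Num.Theory.ltr0n // -GRing.natrM Num.Theory.ler_nat.
apply: leq_trans (_ : \sum_(tape : t.-tuple 'I_(2 ^ W)) b <= _).
  by apply: leq_sum => tape _; apply: H.
by rewrite sum_nat_const card_tuple card_ord mulnC.
Qed.

Lemma wp_correct p (Q : Prop) s b :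
  wp W p (fun s' _ => accepts s' <-> Q) s b ->
  decides W (p, s) Q /\ expected_time_le W (p, s) b.
Proof.
move=> [t [s' [tb Hx HQ]]].
have Hrun tape : size tape = t -> run W (p, s) tape = ([::], s') by apply: exec_run.
split=> [tape _|].
  case E: (run W (p, s) tape) => [[|c q] s2] //= _.
  (* Padding the tape changes nothing after halting and makes it long enough for the derivation to
     apply. *)
  have E1 : run W (p, s) (tape ++ nseq t 0) = ([::], s2).
    by rewrite /run foldl_cat -!/(run _ _ _) E run_halted.
  have E2 : run W (p, s) (tape ++ nseq t 0) = ([::], s').
    rewrite -(cat_take_drop t (tape ++ _)) /run foldl_cat -!/(run _ _ _) Hrun ?run_halted //.
    by rewrite size_takel // size_cat size_nseq leq_addl.
  by move: E1; rewrite E2 => -[<-].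
apply: expected_time_leP => tape; apply: leq_trans tb.
case: (leqP (size tape) t) => H; first exact: leq_trans (run_time_size _ _) H.
by apply: run_time_le; rewrite Hrun // size_takel // ltnW.
Qed.

End Machine.

(** An occurrence ending at [j] begins at [j - size v], an injective map as [size v <= j]. *)
Lemma leq_count_suffix (A : eqType) (v w : seq A) :
  count (fun j => suffix v (take j w)) (iota 0 (size w).+1) <=
  count (fun i => prefix v (drop i w)) (iota 0 (size w).+1).
Proof.
rewrite -!size_filter -(size_map (subn^~ (size v))); apply: uniq_leq_size.
  rewrite map_inj_in_uniq ?filter_uniq ?iota_uniq // => i j.
  rewrite !mem_filter !mem_iota !add0n => /and3P[/size_suffix Hi _ iw] /and3P[/size_suffix Hj _ jw].
  by rewrite !size_takel // in Hi Hj; lia.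
move=> k /mapP[j]; rewrite mem_filter mem_iota add0n => /and3P[Hs _ jw] ->.
have sz := size_suffix Hs; rewrite size_takel // in sz.
rewrite mem_filter mem_iota add0n; apply/andP; split; last by lia.
move: Hs; rewrite suffixE size_takel // => /eqP E.
by rewrite prefixE take_drop subnKC // E.
Qed.

(** * From lists of words back to the morphism *)

Section Interpretation.
Variables (Sigma Gamma : finType) (phi : Sigma -> seq Gamma).
Hypothesis phi_inj : injective (morph phi).

Local Notation ws := [seq phi c | c <- enum Sigma].

Lemma morph1 c : morph phi [:: c] = phi c.
Proof. exact: cats0. Qed.

Lemma phi_neq0 c : phi c != [::].
Proof. by apply/eqP => E; have := @phi_inj [:: c] [::]; rewrite morph1 E => /(_ erefl). Qed.

Lemma phi_letters_inj : injective phi.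
Proof. by move=> c d E; have := @phi_inj [:: c] [:: d]; rewrite !morph1 => /(_ E)[]. Qed.

Lemma ws_uniq : uniq ws.
Proof. by rewrite map_inj_uniq ?enum_uniq //; apply: phi_letters_inj. Qed.

Lemma images_ws : images phi = ws.
Proof. exact: undup_id ws_uniq. Qed.

Lemma phi_nil : [::] \notin ws.
Proof. by apply/mapP => -[c _ E]; have := phi_neq0 c; rewrite -E. Qed.

Lemma nth_ws c : nth [::] ws (enum_rank c) = phi c.
Proof. by rewrite (nth_map c) ?nth_enum_rank // -cardE ltn_ord. Qed.

Lemma total_length_ws : total_length phi = size (flatten ws).
Proof. by rewrite /total_length images_ws size_flatten /shape sumnE !big_map. Qed.

(** Exchanging the sums counts each occurrence at its end; the end 0 is dropped. *)
Lemma total_occ_ge (w : seq Gamma) :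
  \sum_(1 <= j < (size w).+1) cnt ws (take j w) <= total_occ phi w.
Proof.
rewrite /total_occ images_ws.
apply: leq_trans (leq_sum _ (fun v _ => leq_count_suffix v w)).
rewrite (eq_bigr (fun v => \sum_(0 <= j < (size w).+1) suffix v (take j w))); last first.
  by move=> v _; rewrite -sum1_count big_mkcond /index_iota subn0.
rewrite exchange_big /= [X in _ <= X]big_nat_recl //=.
rewrite big_add1 /=; apply: leq_trans (leq_addl _ _).
by apply: leq_sum => j _; rewrite /cnt -sum1_count big_mkcond.
Qed.

Lemma interf_ws w : interf ws w <-> interfered_image_factorization phi w.
Proof. by rewrite -images_ws. Qed.

Lemma inner_ws w :
  (exists v, [/\ v \in ws, infix w v, ~~ prefix w v & ~~ suffix w v]) <->
  inner_image_factor phi w.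
Proof.
split=> [[v [/mapP[c _ ->] Hi Hp Hs]]|[c [Hi _ Hp Hs]]].
  by exists c; split=> // E; rewrite E prefix_refl in Hp.
by exists (phi c); split=> //; apply: map_f; rewrite mem_enum.
Qed.

End Interpretation.

Theorem theorem11 :
  exists (p : program) (c C : nat),
    forall (Sigma Gamma : finType) (phi : Sigma -> seq Gamma) (u : seq Sigma),
      injective (morph phi) ->
      let m := total_length phi in
      let w := morph phi u in
      let n := size w in
      let occs := total_occ phi w in
      forall W : nat, (m + n + 2) ^ c <= 2 ^ W -> #|Gamma| <= 2 ^ W ->
        decides W (p, input phi u) (interference_free phi (fun v => v = u)) /\
        expected_time_le W (p, input phi u) (C * (m + n + occs + 1)).
Proof.
(* For empty [u] the condition is vacuous, while the layout needs [w] non-empty. The exponent 2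
   keeps numbers below [(N + 2) ^ 2] from overflowing, with [N = m + n]; 150 covers
   [140 * N + 70 + 4 * occs] and the first test. *)
exists [:: If (Reg 1) algorithm [:: Assign 0 (Const 1)]], 2, 150.
move=> Sigma Gamma phi u phi_inj m w n occs W HW _; apply: wp_correct.
pose ws := [seq phi c | c <- enum Sigma].
pose us := [seq val (enum_rank c) | c <- u].
have Ew : flatten [seq nth [::] ws c | c <- us] = w.
  by rewrite /w /morph -map_comp; congr flatten; apply: eq_map => c /=; rewrite nth_ws.
apply: wp_if; first by lia.
  rewrite eval_reg cats0 /= => u0.
  have us0 : us != [::] by rewrite -size_eq0 size_map.
  have us_ws c : c \in us -> c < size ws.
    by move=> /mapP[d _ ->]; rewrite size_map -cardE ltn_ord.
  have w_neq0 := w_nil (phi_nil phi_inj) us_ws us0; rewrite Ew in w_neq0.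
  have [a0 _] : exists a, a \in w by case: (w) w_neq0 => // a l _; exists a; rewrite mem_head.
  have Hm : m = size (flatten ws) by apply: total_length_ws.
  have HN : size (flatten (rcons ws (flatten [seq nth [::] ws c | c <- us]))) = m + n.
    by rewrite flatten_rcons size_cat Ew Hm.
  apply: wp_weaken; first apply: (algorithm_ok (a0 := a0) (ws := ws) (us := us)
    (rank := fun a => val (enum_rank a))) => //.
  - exact: phi_nil.
  - by rewrite HN; move: HW; rewrite expnS expn1; lia.
  - by move=> a b /val_inj/enum_rank_inj.
  - exact: ws_uniq.
  - by move=> x; rewrite /ws /us 2!size_map -cardE.
  - by move=> p pm; rewrite /= (nth_map a0).
  - by move=> c cw; rewrite -(nth_map [::] 0 size) // /ws -map_comp.
  - by move=> a p a2; case: a a2 => [|[|[|a]]] //= _; rewrite nth_nil.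
  - have := total_occ_ge phi_inj w; rewrite -/occs HN Ew -/ws.
    by set Sg := \sum_(_ <= _ < _) _; lia.
  move=> s' k' _ H; rewrite /accepts H Ew interf_ws // inner_ws; split.
    by move=> H1 v ->.
  by move=> H1; apply: (H1 u) => // E; rewrite E in u0.
rewrite eval_reg /= => /size0nil u0; apply: wp_assign; first by lia.
apply: wp_nil; rewrite /accepts /= /upd /= eval_const modn_small; last first.
  by apply: leq_trans HW; rewrite expnS expn1; nia.
by split=> // _ v ->; rewrite u0.
Qed.
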